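(* Let $-\infty<a<b<\infty$ and $-\infty<c<d<\infty$ with either $b<c$ or $d<a$, let $x_1<\cdots<x_n$ be points in $[a,b]$ and $y_1<\cdots<y_n$ points in $[c,d]$, let $\underline{r},\underline{s}\in\mathbb{C}^{n}$, and let $L_n$ be the $n\times n$ L\''owner matrix with entries $(L_n)_{jk}=\frac{r_j-s_k}{x_j-y_k}$, $1\le j,k\le n$. Let $\gamma=\frac{|c-a|\,|d-b|}{|c-b|\,|d-a|}$ be the absolute value of the cross-ratio of $a,b,c,d$. Then, for every $0<\epsilon<1$, \[ \mathrm{rank}_\epsilon(L_n)\le 2\left\lceil\frac{\log(16\gamma)\,\log(4/\epsilon)}{\pi^2}\right\rceil. \]
   Context: $\sigma_1(X)\ge\cdots\ge\sigma_n(X)\ge 0$ denote the singular values of an $n\times n$ matrix $X$, with the convention $\sigma_{n+1}(X)=0$, and $\|X\|_2=\sigma_1(X)$. For $0<\epsilon<1$, the $\epsilon$-rank is $\mathrm{rank}_\epsilon(X)=\min\{k\ge 0:\sigma_{k+1}(X)\le\epsilon\|X\|_2\}$. *)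

(* Defs.v *)
From mathcomp Require Import all_boot all_order all_algebra.
From mathcomp Require Import complex.
From mathcomp Require Import reals exp trigo.

Set Implicit Arguments.
Unset Strict Implicit.
Unset Printing Implicit Defensive.

Import Order.TTheory GRing.Theory Num.Theory.
Local Open Scope ring_scope.
Local Open Scope complex_scope.
Local Open Scope sesquilinear_scope.

Lemma gram_spectral (R : realType) (n : nat) (X : 'M[R[i]]_n) :
  let G := X ^t* *m X in let U := spectralmx G in
  [/\ U \is unitarymx, G = U ^t* *m diag_mx (spectral_diag G) *m U
    & forall j, 0 <= spectral_diag G 0 j].
Proof.
move=> G U; have Uu : U \is unitarymx by exact: spectral_unitarymx.
have GE : G = U ^t* *m diag_mx (spectral_diag G) *m U.
  rewrite -invmx_unitary //; apply/orthomx_spectralP; apply/normalmxP.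
  by rewrite /G !trmx_mul !map_mxM !trmxCK.
split=> // j; set Y := X *m U ^t*.
have DE : diag_mx (spectral_diag G) = Y ^t* *m Y.
  have DG : diag_mx (spectral_diag G) = U *m G *m U ^t*.
    rewrite [X in _ = U *m X *m _]GE !mulmxA (unitarymxP Uu) mul1mx.
    by rewrite -mulmxA (unitarymxP Uu) mulmx1.
  by rewrite {1}DG /Y trmx_mul map_mxM trmxCK /G !mulmxA.
have := congr1 (fun M : 'M_n => M j j) DE; rewrite !mxE eqxx mulr1n => ->.
by apply: sumr_ge0 => k _; rewrite !mxE mulrC mul_conjC_ge0.
Qed.

(* The eigenvalues of the Hermitian matrix X^* X, listed with multiplicity by
   spectral_diag, are real and nonnegative (gram_spectral), so that Re loses
   nothing. *)
Definition singular_values (R : realType) (n : nat) (X : 'M[R[i]]_n) : seq R :=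
  sort >=%R
    [seq Num.sqrt (complex.Re (spectral_diag (X ^t* *m X) 0 j)) | j : 'I_n].

(* sigma X k is the k-th largest singular value for 1 <= k <= n, and 0 for
   k > n; the index 0 is not used. *)
Definition sigma (R : realType) (n : nat) (X : 'M[R[i]]_n) (k : nat) : R :=
  (singular_values X)`_k.-1.

Definition norm2 (R : realType) (n : nat) (X : 'M[R[i]]_n) : R := sigma X 1.

(* Since sigma X n.+1 = 0, the minimum over all k is attained for some
   k <= n when 0 <= eps; see eps_rankP. *)
Definition eps_rank (R : realType) (n : nat) (eps : R) (X : 'M[R[i]]_n) : nat :=
  [arg min_(k < (ord_max : 'I_n.+1) | sigma X k.+1 <= eps * norm2 X) (k : nat)].

Definition loewner (R : realType) (n : nat) (x y : 'I_n -> R)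
    (r s : 'cV[R[i]]_n) : 'M[R[i]]_n :=
  \matrix_(j < n, k < n) ((r j 0 - s k 0) / (x j - y k)%:C).

Definition cross_ratio (R : realType) (a b c d : R) : R :=
  (`|c - a| * `|d - b|) / (`|c - b| * `|d - a|).

Lemma size_singular_values (R : realType) (n : nat) (X : 'M[R[i]]_n) :
  size (singular_values X) = n.
Proof. by rewrite size_sort size_map -cardE card_ord. Qed.

Lemma sigma_ge0 (R : realType) (n : nat) (X : 'M[R[i]]_n) (k : nat) :
  0 <= sigma X k.
Proof.
rewrite /sigma; case: (ltnP k.-1 (size (singular_values X))) => h; last first.
  by rewrite nth_default.
have := mem_nth 0 h; rewrite mem_sort => /mapP[j _ ->]; exact: sqrtr_ge0.
Qed.

Lemma sigma_default (R : realType) (n : nat) (X : 'M[R[i]]_n) (k : nat) :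
  (n < k)%N -> sigma X k = 0.
Proof.
move=> nk; rewrite /sigma nth_default // size_singular_values.
by case: k nk.
Qed.

Lemma sigma_nonincreasing (R : realType) (n : nat) (X : 'M[R[i]]_n)
    (k l : nat) : (k <= l)%N -> sigma X l <= sigma X k.
Proof.
move=> kl; case: (ltnP n l) => [/sigma_default -> | ln]; first exact: sigma_ge0.
case: l kl ln => [|l] kl ln; first by move: kl; rewrite leqn0 => /eqP ->.
have srt : sorted >=%R (singular_values X).
  by apply: sort_sorted => u v; exact: ge_total.
have kl' : (k.-1 <= l)%N by case: k kl.
apply: (sorted_leq_nth ge_trans ge_refl 0 srt) => //;
  rewrite inE size_singular_values //=; exact: leq_ltn_trans kl' ln.
Qed.

Lemma eps_rankP (R : realType) (n : nat) (eps : R) (X : 'M[R[i]]_n) :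
  0 <= eps ->
  sigma X (eps_rank eps X).+1 <= eps * norm2 X /\
  (forall k : nat, sigma X k.+1 <= eps * norm2 X -> (eps_rank eps X <= k)%N).
Proof.
move=> eps_ge0; rewrite /eps_rank; case: arg_minnP => /=.
  by rewrite sigma_default // mulr_ge0 ?sigma_ge0.
move=> i iP imin; split=> // k kP; case: (ltnP k n.+1) => [kn|nk].
  exact: (imin (Ordinal kn)).
by apply: leq_trans nk; rewrite ltnW.
Qed.

(* Main.v *)
Require Import Defs.
From mathcomp Require Import all_boot all_order all_algebra.
From mathcomp Require Import complex.
From mathcomp Require Import all_classical.
From mathcomp Require Import reals ereal normedtype sequences derive.
From mathcomp Require Import realfun exp trigo esum.
From mathcomp Require Import ring lra.
From mathcomp Require Import zify.
Set Implicit Arguments.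
Unset Strict Implicit.
Unset Printing Implicit Defensive.
Import Order.TTheory GRing.Theory Num.Theory.
Import numFieldNormedType.Exports.
Local Open Scope ring_scope.
Local Open Scope complex_scope.

(** Let [p] and [q] map the interval of the nodes [x] and the interval of the
nodes [y] into an interval [[0, k0]] of [[0, 1)] in such a way that
[1 - p x * q y] equals [x - y] up to a factor depending on [x] alone and a
factor depending on [y] alone ([moebius_separate]).  For a Blaschke factor
[B t = (t - xi) / (1 - xi * t)], the number [1 - B (p x) * B (q y)] is a
separated multiple of [1 - p x * q y], so that multiplying the entries of a
Loewner matrix [L] by [1 - B (p x_j) * B (q y_l)] cancels the denominators and
leaves a matrix of rank at most two.  After [k] Blaschke factors, [L] differs
by rank at most [2 * k] from a matrix [D1 *m L *m D2] with [D1], [D2] diagonal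
and bounded by the maximum [M] of the Blaschke product on [[0, k0]].  Hence
[sigma L (2 * k).+1 <= M ^+ 2 * norm2 L] ([sigma_loewner_le]).

The remaining question is Zolotarev's problem of choosing the zeros of the
Blaschke product.  It is solved with the function [snq L], which is Jacobi's
[sqrt kappa * sn] in a normalisation where it is, up to sign, the product of
[tanh (w - i * L)] over all integers [i] ([snq_prod]).  It satisfies

  [snq (u + v) * snq (u - v) =
     (snq u ^+ 2 - snq v ^+ 2) / (1 - snq u ^+ 2 * snq v ^+ 2)]

([snq_add]), and [u |-> snq u ^+ 2] maps the line onto [[0, snq_mod L]].  If the
zeros are [snq L v ^+ 2] at [k] equally spaced points [v], the Blaschke product
at [snq L u ^+ 2] is therefore a product of [2 * k] translates of [snq L], and
this product of hyperbolic tangents is [snq (L / (2 * k))].  So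
[M ^+ 2 <= snq_mod (L / (2 * k))] ([zolotarev]).  The two constants of the
theorem come from two estimates of [snq_mod]: [1 - snq_mod L ^+ 2 <= 16 * expR (- L)]
([snq_mod_ge]) makes [L = ln (16 * gamma)] admissible, and
[snq_mod d <= 4 * expR (- (pi ^+ 2 / (2 * d)))] ([snq_mod_le]) is the decay.

The function [snq] is defined as a quotient of theta series.  Its addition
formula is the rotation by 45 degrees of a double Gaussian sum ([psi_mul]); its
product formula is the finite Jacobi triple product ([qbinomial]) in the limit
([tannery_int]).  For the decay, Landen's inequality
[snq_mod (2 * d) ^+ 2 <= 4 * snq_mod d] shows that [d * ln (4 / snq_mod d)] does
not increase when [d] is halved, so it is at least its limit as [d] tends to 0.
There the constant 4 is invisible and the product formula gives [4] times the
sum of the inverse odd squares, that is [pi ^+ 2 / 2]. *)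

(** * Periodic Gaussian sums *)

Section Gauss.
Variable R : realType.
Implicit Types (m x y u v : R) (n : int).

Definition gauss m x n : R := expR (- (m * (n%:~R - x) ^+ 2)).

(** Jacobi's theta function of nome [expR (- m)], with the quadratic exponential
factor [expR (m * x ^+ 2)] divided out: this makes it periodic and even. *)
Definition psi m x : R :=
  fine (\esum_(n in [set: int]) (gauss m x n)%:E).

Lemma esumZl (T : choiceType) (k : R) (f : T -> \bar R) : 0 <= k ->
  (forall i, (0 <= f i)%E) ->
  (\esum_(i in [set: T]) (k%:E * f i) = k%:E * \esum_(i in [set: T]) f i)%E.
Proof.
move=> k0 f0; rewrite /esum -ereal_supZl //; last first.
  by apply/set0P; exists (\sum_(i \in set0) f i)%E; exists set0 => //; exact: fsets_set0.
congr ereal_sup; apply/seteqP; split=> [_ [A hA <-]|_ [_ [A hA <-] <-]].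
  exists (\sum_(i \in A) f i)%E; first by exists A.
  by rewrite ge0_mule_fsumr.
by exists A => //; rewrite ge0_mule_fsumr.
Qed.

Lemma esum_int_nat (f : int -> \bar R) : (forall i, 0 <= f i)%E ->
  (\esum_(n in [set: int]) f n =
   \sum_(i <oo) f (Posz i) + \sum_(i <oo) f (Negz i))%E.
Proof.
move=> f0; rewrite !nneseries_esumT //.
rewrite (esumID [set Posz i | i in [set: nat]]) //; congr (_ + _)%E.
  by rewrite setTI esum_image // => a b _ _ [].
rewrite setTI (_ : ~` _ = [set Negz i | i in [set: nat]])%classic; last first.
  apply/seteqP; split=> [[i|i] /= h|_ [i _ <-] [j _]] //.
    by exfalso; apply: h; exists i.
  by exists i.
by rewrite esum_image // => a b _ _ [].
Qed.

Lemma gauss_gt0 m x n : 0 < gauss m x n. Proof. exact: expR_gt0. Qed.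

Lemma gauss_ge0 m x n : (0 <= (gauss m x n)%:E)%E.
Proof. by rewrite lee_fin ltW // gauss_gt0. Qed.

(** A Gaussian is dominated by a two-sided geometric sequence, because
[t ^+ 2 >= t - 1 / 4]. *)
Lemma esum_gauss_fin m x : 0 < m ->
  \esum_(n in [set: int]) (gauss m x n)%:E \is a fin_num.
Proof.
move=> m0; rewrite ge0_fin_numE; last by apply: esum_ge0 => n _; exact: gauss_ge0.
rewrite esum_int_nat; last by move=> n; exact: gauss_ge0.
pose K := expR (m * (1/4 + `|x| + 1)); pose r := expR (- m).
have r1 : `|r| < 1 by rewrite ger0_norm ?expR_ge0 // expR_lt1 oppr_lt0.
have bnd n (i : nat) : `|n%:~R| + 1 >= i%:R :> R -> gauss m x n <= geometric K r i.
  move=> hn; rewrite /= /r -expRM_natl /K -expRD ler_expR.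
  rewrite (_ : m * _ + _ = m * (1/4 + `|x| + 1 - i%:R)); last by ring.
  rewrite -mulrN ler_pM2l //.
  have h1 : `|n%:~R| <= `|n%:~R - x| + `|x| by rewrite -{1}(subrK x n%:~R) ler_normD.
  rewrite -real_normK ?num_real //; set t := `|n%:~R - x| in h1 *.
  have : 0 <= (t - 1/2) ^+ 2 by exact: sqr_ge0.
  rewrite !expr2; lra.
have gfin : (\sum_(i <oo) (geometric K r i)%:E < +oo)%E.
  have /cvg_lim -> // : ((fun N : nat => \sum_(0 <= i < N) (geometric K r i)%:E)%E @ \oo --> (K * (1 - r)^-1)%:E)%classic.
    rewrite (_ : (fun N : nat => _) = EFin \o series (geometric K r)).
      by apply: cvg_EFin; [exact: nearW | exact: cvg_geometric_series].
    by apply/funext => N /=; rewrite sumEFin.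
  by rewrite ltry.
apply: lte_add_pinfty; apply: le_lt_trans gfin; apply: lee_nneseries => *;
  first [exact: gauss_ge0 | rewrite lee_fin; apply: bnd].
  by rewrite -pmulrn ger0_norm // lerDl.
by rewrite NegzE mulrNz normrN -pmulrn ger0_norm // -natr1 -addrA lerDl.
Qed.

Lemma psiE m x : 0 < m ->
  \esum_(n in [set: int]) (gauss m x n)%:E = (psi m x)%:E.
Proof. by move=> m0; rewrite /psi fineK // esum_gauss_fin. Qed.

Lemma gauss_le_psi m x n : 0 < m -> gauss m x n <= psi m x.
Proof.
move=> m0; rewrite -lee_fin -psiE // (esumID [set n]) //; last first.
  by move=> i _; exact: gauss_ge0.
rewrite setTI esum_set1 ?gauss_ge0 // leeDl // esum_ge0 // => i _.
exact: gauss_ge0.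
Qed.

Lemma psi_gt0 m x : 0 < m -> 0 < psi m x.
Proof. by move=> m0; apply: lt_le_trans (gauss_le_psi x 0 m0); exact: gauss_gt0. Qed.

Lemma psiD1 m x : psi m (x + 1) = psi m x.
Proof.
rewrite /psi; congr fine.
rewrite (@reindex_esum _ _ _ [set: int] [set: int] (fun n => n + 1)).
  apply: eq_esum => n _; congr EFin; rewrite /gauss intrD.
  by congr (expR (- (_ * _ ^+ 2))); lra.
split=> [|a b _ _|n _]; [done|exact: addIr|idtac].
by exists (n - 1) => //; rewrite subrK.
Qed.

Lemma psiN m x : psi m (- x) = psi m x.
Proof.
rewrite /psi; congr fine.
rewrite (@reindex_esum _ _ _ [set: int] [set: int] (fun n => - n)).
  apply: eq_esum => n _; congr EFin; rewrite /gauss mulrNz.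
  by rewrite -opprD sqrrN.
split=> [|a b _ _|n _]; [done|exact: oppr_inj|idtac].
by exists (- n) => //; rewrite opprK.
Qed.

Lemma esum_prod (f g : int -> \bar R) : (forall i, 0 <= f i)%E ->
  (forall i, 0 <= g i)%E -> (forall i, f i \is a fin_num) ->
  (\esum_(i in [set: int]) g i \is a fin_num) ->
  ((\esum_(i in [set: int]) f i) * (\esum_(i in [set: int]) g i) =
   \esum_(k in [set: int * int]) (f k.1 * g k.2))%E.
Proof.
move=> f0 g0 ffin gfin.
rewrite (_ : [set: int * int] = [set: int] `*`` (fun => [set: int]))%classic; last first.
  by apply/seteqP; split.
rewrite -(@esum_esum _ _ _ _ _ (fun i j => f i * g j)%E); last first.
  by move=> i j _ _; rewrite mule_ge0.
rewrite -(fineK gfin) muleC -esumZl //; last exact/fine_ge0/esum_ge0.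
apply: eq_esum => i _; rewrite -(fineK (ffin i)) esumZl ?fine_ge0 //.
by rewrite fineK // fineK // muleC.
Qed.

(** The change of variables [(s, t) |-> (s + t, s - t)] rotates the Gaussian
lattice sum over [int * int] by 45 degrees.  Its image consists of the pairs
with even difference; the pairs with odd difference are the translate of this
sublattice by [(1, 0)] and give the second product. *)
Lemma psi_mul m a b : 0 < m ->
  psi m a * psi m b =
    psi (2 * m) ((a + b) / 2) * psi (2 * m) ((a - b) / 2) +
    psi (2 * m) ((a + b - 1) / 2) * psi (2 * m) ((a - b - 1) / 2).
Proof.
move=> m0; have m20 : 0 < 2 * m by rewrite mulr_gt0.
apply: EFin_inj; rewrite EFinD !EFinM -!psiE //.
rewrite !esum_prod ?esum_gauss_fin //; do ?[by move=> i; exact: gauss_ge0].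
pose P := [set k : int * int | (2 %| (k.1 - k.2))%Z]%classic.
rewrite (esumID P); last by move=> k _; rewrite mule_ge0 // gauss_ge0.
rewrite !setTI; congr (_ + _)%E.
  rewrite (@reindex_esum _ _ _ [set: int * int] P (fun k => (k.1 + k.2, k.1 - k.2))).
    apply: eq_esum => -[s t] _ /=; rewrite -!EFinM /gauss -!expRD; congr (expR _)%:E.
    by rewrite !intrD !mulrNz; field.
  split=> [[s t] _|[s t] [s' t'] _ _ [] /= h1 h2|[s t]]; rewrite /P /=.
  - by apply/dvdzP; exists t; lia.
  - by congr pair; lia.
  - move=> /dvdzP[q hq]; exists (t + q, q) => //=; congr pair; lia.
rewrite (@reindex_esum _ _ _ [set: int * int] (~` P)%classic (fun k => (k.1 + k.2 + 1, k.1 - k.2))).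
  apply: eq_esum => -[s t] _ /=; rewrite -!EFinM /gauss -!expRD; congr (expR _)%:E.
  by rewrite !intrD !mulrNz; field.
split=> [[s t] _|[s t] [s' t'] _ _ [] /= h1 h2|[s t]]; rewrite /P /=.
- by move=> /dvdzP[q hq]; lia.
- by congr pair; lia.
- move=> h; exists (t + ((s - t) %/ 2)%Z, ((s - t) %/ 2)%Z) => //=.
  have h2 : ((s - t) %% 2)%Z = 1.
    have := modz_ge0 (s - t) (isT : 2 != 0 :> int).
    have := ltz_pmod (s - t) (isT : 0 < 2 :> int).
    have : ((s - t) %% 2)%Z != 0 by apply/eqP => /dvdz_mod0P /h.
    by lia.
  have := divz_eq (s - t) 2; rewrite h2 => e; congr pair; lia.
Qed.

End Gauss.

(** * The finite Jacobi triple product and its limit *)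

Section QBinomial.
Variables (R : realType) (Q : R).
Hypotheses (Q0 : 0 < Q) (Q1 : Q < 1).
Implicit Types (M N j k : nat) (y : R).

(** Gaussian binomial coefficients in the variable [Q]. *)
Fixpoint qbin M j : R :=
  match M, j with
  | _, 0%N => 1
  | 0%N, _.+1 => 0
  | M'.+1, j'.+1 => qbin M' j'.+1 + Q ^+ (M' - j') * qbin M' j'
  end.

Lemma qbin0r M : qbin M 0 = 1. Proof. by case: M. Qed.

Lemma qbin_small M j : (M < j)%N -> qbin M j = 0.
Proof.
elim: M j => [|M IH] [|j] //= h.
by rewrite !IH ?mulr0 ?addr0 // ltnW.
Qed.

Lemma qbinomial M y :
  \prod_(i < M) (1 + y * Q ^+ i) =
  \sum_(j < M.+1) qbin M j * Q ^+ 'C(j, 2) * y ^+ j.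
Proof.
elim: M => [|M IH]; first by rewrite big_ord0 big_ord1 /= !mul1r.
rewrite big_ord_recr /= IH mulrDr mulr1 [RHS]big_ord_recl /=.
transitivity (1 + \sum_(j < M.+1) qbin M j.+1 * Q ^+ 'C(j.+1, 2) * y ^+ j.+1 +
   \sum_(j < M.+1) Q ^+ (M - j) * qbin M j * Q ^+ 'C(j.+1, 2) * y ^+ j.+1).
  congr (_ + _).
    rewrite big_ord_recl /= qbin0r !mul1r; congr (_ + _).
    by rewrite big_ord_recr /= [qbin M M.+1]qbin_small // !mul0r addr0.
  rewrite mulr_suml; apply: eq_bigr => j _.
  rewrite binS bin1 exprD exprS.
  have -> : Q ^+ M = Q ^+ (M - j) * Q ^+ j by rewrite -exprD subnK // -ltnS.
  by ring.
rewrite !mul1r -addrA -big_split /=; congr (_ + _).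
by apply: eq_bigr => j _; rewrite !mulrDl.
Qed.

Definition qfact k : R := \prod_(i < k) (1 - Q ^+ i.+1).

Lemma qfactor_gt0 j : 0 < 1 - Q ^+ j.+1.
Proof. by rewrite subr_gt0 exprn_ilt1 // ltW. Qed.

Lemma qfact_gt0 k : 0 < qfact k.
Proof. by apply: prodr_gt0 => i _; exact: qfactor_gt0. Qed.

Lemma qfactS k : qfact k.+1 = qfact k * (1 - Q ^+ k.+1).
Proof. by rewrite /qfact big_ord_recr. Qed.

Lemma qbin_fact M j : (j <= M)%N -> qbin M j * (qfact j * qfact (M - j)) = qfact M.
Proof.
elim: M j => [|M IH] [|j] //=.
- by rewrite /qfact big_ord0 !mul1r.
- by rewrite /qfact big_ord0 !mul1r.
rewrite ltnS => jM; rewrite subSS mulrDl.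
have -> : Q ^+ (M - j) * qbin M j * (qfact j.+1 * qfact (M - j)) =
  Q ^+ (M - j) * (1 - Q ^+ j.+1) * qfact M by rewrite -(IH j jM) qfactS; ring.
move: jM; rewrite leq_eqVlt => /orP[/eqP <-|jM].
  by rewrite qbin_small // mul0r add0r subnn expr0 mul1r qfactS mulrC.
rewrite -{1}(subnSK jM) (qfactS (M - j.+1)) subnSK //.
transitivity ((1 - Q ^+ (M - j)) * (qbin M j.+1 * (qfact j.+1 * qfact (M - j.+1)))
   + Q ^+ (M - j) * (1 - Q ^+ j.+1) * qfact M); first by ring.
rewrite IH // qfactS.
have -> : Q ^+ M.+1 = Q ^+ (M - j) * Q ^+ j.+1.
  by rewrite -exprD addnS subnK // ltnW.
by ring.
Qed.

Lemma qfactD k n : qfact (k + n) = qfact k * \prod_(i < n) (1 - Q ^+ (k + i).+1).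
Proof. by rewrite /qfact big_split_ord. Qed.

(** The coefficients of the finite triple product, normalised by the central one:
unlike the Gaussian binomials they are bounded by 1 and tend to 1, so that the
infinite product of the [1 - Q ^+ i] never has to be considered. *)
Definition qweight N j : R := qbin (N + N) j / qbin (N + N) N.

Lemma qbin_gt0 M j : (j <= M)%N -> 0 < qbin M j.
Proof.
move=> jM; rewrite -(pmulr_lgt0 _ (mulr_gt0 (qfact_gt0 j) (qfact_gt0 (M - j)))).
by rewrite qbin_fact // qfact_gt0.
Qed.

Lemma qweightE N j : (j <= N + N)%N ->
  qweight N j = qfact N ^+ 2 / (qfact j * qfact (N + N - j)).
Proof.
move=> jN; have q k : qfact k != 0 by rewrite gt_eqF // qfact_gt0.
have h1 := qbin_fact jN; have h2 := qbin_fact (leq_addr N N).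
rewrite addnK in h2; rewrite /qweight.
apply/eqP; rewrite eqr_div; last 2 first.
- by rewrite gt_eqF // qbin_gt0 // leq_addr.
- by rewrite mulf_neq0.
by rewrite h1 expr2 -h2 mulrC.
Qed.

Lemma qweight_sym N j : (j <= N + N)%N -> qweight N (N + N - j) = qweight N j.
Proof.
by move=> jN; rewrite !qweightE ?leq_subr // subKn // [qfact j * _]mulrC.
Qed.

Lemma qweight_addE N n : (n <= N)%N ->
  qweight N (N + n) = \prod_(i < n) ((1 - Q ^+ (N - n + i).+1) / (1 - Q ^+ (N + i).+1)).
Proof.
move=> nN; rewrite qweightE ?leq_add2l // subnDl prodf_div.
have q k : qfact k != 0 by rewrite gt_eqF // qfact_gt0.
rewrite {1}expr2 -{2}(subnK nN) !qfactD; field.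
by rewrite q q /= gt_eqF //; apply: prodr_gt0 => i _; exact: qfactor_gt0.
Qed.

(** Term by term, each factor of the quotient in [qweight_addE] is at most 1 and
at least its numerator. *)
Lemma qweight_add_bounds N n : (n <= N)%N ->
  (1 - Q ^+ (N - n)) ^+ n <= qweight N (N + n) <= 1.
Proof.
move=> nN; rewrite qweight_addE //; apply/andP; split; last first.
  apply: prodr_ile1 => i _; rewrite divr_ge0 ?(ltW (qfactor_gt0 _)) //=.
  rewrite ler_pdivrMr ?qfactor_gt0 // mul1r lerD2l lerN2.
  by apply: ler_wiXn2l; rewrite ?(ltW Q0) ?(ltW Q1) // ltnS leq_add2r leq_subr.
rewrite -{2}(card_ord n) -prodr_const; apply: ler_prod => i _.
rewrite subr_ge0 exprn_ile1 ?(ltW Q0) ?(ltW Q1) //=.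
rewrite ler_pdivlMr ?qfactor_gt0 //.
apply: (@le_trans _ _ (1 - Q ^+ (N - n))).
  apply: ler_piMr; first by rewrite subr_ge0 exprn_ile1 ?(ltW Q0) ?(ltW Q1).
  by rewrite gerBl exprn_ge0 // ltW.
rewrite lerD2l lerN2; apply: ler_wiXn2l; rewrite ?(ltW Q0) ?(ltW Q1) //.
by rewrite -addnS leq_addr.
Qed.

Lemma qweight_bounds N j : (j <= N + N)%N -> 0 <= qweight N j <= 1.
Proof.
wlog jN : j / (N <= j)%N.
  move=> H jN2; case: (leqP N j) => h; first exact: H.
  rewrite -qweight_sym //; apply: H; lia.
move=> jN2; rewrite /qweight divr_ge0 ?(ltW (qbin_gt0 _)) ?leq_addr //=.
rewrite -/(qweight N j) -(subnKC jN).
have /qweight_add_bounds/andP[] // : (j - N <= N)%N by lia.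
Qed.

Local Open Scope classical_set_scope.

Lemma qweight_cvg n : (fun N : nat => qweight N (N + n)) @ \oo --> (1 : R).
Proof.
have cQ : (fun N : nat => Q ^+ N) @ \oo --> (0 : R).
  by apply: cvg_expr; rewrite ger0_norm // ltW.
have c1 m : (fun N : nat => (1 - Q ^+ (N - n)) ^+ m) @ \oo --> (1 : R).
  have c0 : (fun N : nat => 1 - Q ^+ (N - n)) @ \oo --> (1 : R).
    rewrite -[X in _ --> X](subr0 (1 : R)); apply: cvgB; first exact: cvg_cst.
    rewrite -(@cvg_shiftn n) (_ : [sequence _]_n = (fun N => Q ^+ N)) //.
    by apply/funext => N /=; rewrite addnK.
  elim: m => [|m IH]; first exact: cvg_cst.
  rewrite -[X in _ --> X](mulr1 (1 : R)); under eq_fun do rewrite exprS.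
  exact: cvgM.
apply: (squeeze_cvgr _ (c1 n) (cvg_cst (1 : R))).
exists n => // N /= nN; exact: qweight_add_bounds.
Qed.

End QBinomial.

Section Tannery.
Variable R : realType.
Local Open Scope classical_set_scope.

(** Dominated convergence for series: a head of the series converges termwise,
and the weights being at most 1 bounds the rest by the tail of [h]. *)
Lemma tannery (h : nat -> R) (s : R) (w : nat -> nat -> R) (c : nat) :
  (forall k, 0 <= h k) -> (\sum_(i <oo) (h i)%:E)%E = s%:E ->
  (forall N k, (k < N + c)%N -> 0 <= w N k <= 1) ->
  (forall k, (fun N => w N k) @ \oo --> (1 : R)) ->
  (fun N : nat => \sum_(k < N + c) w N k * h k) @ \oo --> s.
Proof.
move=> h0 hs w01 w1.
have hle N : series h N <= s.
  rewrite -lee_fin -hs -sumEFin; apply: nneseries_lim_ge => k _ _.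
  by rewrite lee_fin.
have hcv : series h @ \oo --> s.
  have := @is_cvg_nneseries R (EFin \o h) xpredT 0%N (fun n _ _ => (h0 n : (0 <= (h n)%:E)%E)).
  rewrite /= hs.
  rewrite (_ : (fun _ => _) = EFin \o series h); first by move/fine_cvgP => [_].
  by apply/funext => N; rewrite /= sumEFin.
apply/cvgrPdist_le => e e0; have e2 : 0 < e / 2 by rewrite divr_gt0.
have /cvgrPdist_le/(_ _ e2)[M _ HM] := hcv.
have cM : (fun N => \sum_(k < M) w N k * h k) @ \oo --> series h M.
  rewrite /series /= big_mkord; elim: (M) => [|m IH].
    by under eq_fun do rewrite big_ord0; rewrite big_ord0; exact: cvg_cst.
  under eq_fun do rewrite big_ord_recr /=; rewrite big_ord_recr /=.
  apply: cvgD => //; rewrite -[X in _ --> X]mul1r.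
  by apply: cvgM => //; exact: cvg_cst.
have /cvgrPdist_le/(_ _ e2)[M' _ HM'] := cM.
exists (maxn M M') => // N /=; rewrite geq_max => /andP[MN M'N].
have := HM' N M'N; have := HM M (leqnn M).
rewrite !ler_norml => /andP[_ a1] /andP[_ a2].
have u : \sum_(k < N + c) w N k * h k <= s.
  apply: le_trans (hle (N + c)%N); rewrite /series /= big_mkord.
  apply: ler_sum => k _; apply: ler_piMl => //.
  by have /andP[] := w01 N k (ltn_ord k).
have l : \sum_(k < M) w N k * h k <= \sum_(k < N + c) w N k * h k.
  have MNc : (M <= N + c)%N by rewrite (leq_trans MN) // leq_addr.
  rewrite (big_ord_widen _ (fun k => w N k * h k) MNc) big_mkcond /=.
  apply: ler_sum => k _; case: ifP => // _.
  by rewrite mulr_ge0 //; have /andP[] := w01 N k (ltn_ord k).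
by move: a1 a2 u l => *; apply/andP; split; lra.
Qed.

Lemma tannery_int (f : int -> R) (s : R) (w : nat -> nat -> R) :
  (forall n, 0 <= f n) -> (\esum_(n in [set: int]) (f n)%:E)%E = s%:E ->
  (forall N j, (j <= N + N)%N -> 0 <= w N j <= 1) ->
  (forall n, (fun N => w N (N + n)%N) @ \oo --> (1 : R)) ->
  (forall N j, (j <= N + N)%N -> w N (N + N - j)%N = w N j) ->
  (fun N : nat => \sum_(j < (N + N).+1) w N j * f (j%:Z - N%:Z)) @ \oo --> s.
Proof.
move=> f0 fs w01 w1 wsym.
have f0' n : (0 <= (f n)%:E)%E by rewrite lee_fin.
have := fs; rewrite (@esum_int_nat R (fun n => (f n)%:E)) //.
set s1 := (X in (X + _)%E = _ -> _); set s2 := (X in (_ + X)%E = _ -> _) => hs.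
have s1p : (0 <= s1)%E by apply: nneseries_ge0.
have s2p : (0 <= s2)%E by apply: nneseries_ge0.
have s1f : s1 \is a fin_num.
  by rewrite ge0_fin_numE //; apply: le_lt_trans (ltry s); rewrite -hs leeDl.
have s2f : s2 \is a fin_num.
  by rewrite ge0_fin_numE //; apply: le_lt_trans (ltry s); rewrite -hs leeDr.
have -> : s = fine s1 + fine s2 by rewrite -fineD // hs.
pose w2 N k := w N (N + k.+1)%N.
have c1 := @tannery (fun k => f (Posz k)) (fine s1) (fun N k => w N (N + k)%N) 1
  (fun k => f0 _) (esym (fineK s1f)).
have c2 := @tannery (fun k => f (Negz k)) (fine s2) w2 0
  (fun k => f0 _) (esym (fineK s2f)).
rewrite (_ : (fun N => _) = (fun N : nat => \sum_(k < N + 1) w N (N + k)%N * f (Posz k) +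
   \sum_(k < N + 0) w2 N k * f (Negz k))).
  apply: cvgD.
    by apply: c1 => // N k; rewrite addn1 ltnS => kN; apply: w01; rewrite leq_add2l.
  by apply: c2 => [N k|k]; rewrite ?addn0 /w2 // => kN; apply: w01; rewrite leq_add2l.
apply/funext => N; rewrite addn0 addn1 -addnS big_split_ord /= addrC; congr (_ + _).
  by apply: eq_bigr => k _; congr (_ * f _); rewrite PoszD addrC addKr.
rewrite (reindex_inj rev_ord_inj) /=; apply: eq_bigr => k _; have kN := ltn_ord k.
rewrite /w2 -wsym; last by lia.
by congr (w N _ * f _); rewrite ?NegzE; lia.
Qed.

End Tannery.

(** * The elliptic sine as a theta quotient *)

Section ThetaQuotient.
Variables (R : realType) (L : R).
Hypothesis L0 : 0 < L.
Implicit Types (w u v x : R).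

Definition tanhR w : R := (expR (2 * w) - 1) / (expR (2 * w) + 1).

(** The terms of even index in the series [psi L (w / L + 1 / 2)]. *)
Definition theta_even w : R := psi (4 * L) ((w / L + 1 / 2) / 2).
(** The terms of odd index in the series [psi L (w / L + 1 / 2)]. *)
Definition theta_odd w : R := psi (4 * L) ((w / L - 1 / 2) / 2).

(** The quotient of the alternating by the plain theta series, with the sign of
[w] near 0.  It is [sqrt kappa * sn] for the modulus [kappa = snq_mod L]; in the
variable [w] its real period is [2 * L]. *)
Definition snq w : R :=
  (theta_odd w - theta_even w) / (theta_odd w + theta_even w).

Let L40 : 0 < 4 * L. Proof. by rewrite mulr_gt0. Qed.

Lemma theta_even_gt0 w : 0 < theta_even w. Proof. exact: psi_gt0. Qed.
Lemma theta_odd_gt0 w : 0 < theta_odd w. Proof. exact: psi_gt0. Qed.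

Definition gauss_parity (b : bool) x (n : int) : R :=
  if odd `|n|%N == b then gauss L x n else 0.

Lemma gauss_parity_ge0 b x n : 0 <= gauss_parity b x n.
Proof. by rewrite /gauss_parity; case: ifP => // _; rewrite ltW // gauss_gt0. Qed.

Lemma esum_gauss_parity (b : bool) w :
  (\esum_(n in [set: int]) (gauss_parity b (w / L + 1 / 2) n)%:E)%E =
  (if b then theta_odd w else theta_even w)%:E.
Proof.
pose P := [set n : int | odd `|n|%N == b]%classic.
transitivity (\esum_(n in P) (gauss L (w / L + 1 / 2) n)%:E)%E.
  rewrite [RHS]esum_mkcond; apply: eq_esum => n _; rewrite /gauss_parity.
  rewrite (_ : (n \in P) = (odd `|n|%N == b)); first by case: ifP.
  by apply/idP/idP; rewrite inE.
rewrite (@reindex_esum _ _ _ [set: int] P (fun m => m * 2 + (b : nat)%:Z)); last first.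
  split=> [m _|m m' _ _ /= |n]; rewrite /P /=.
  - by case: b {P}; lia.
  - by lia.
  - move=> h; exists (n %/ 2)%Z => //=; have := divz_eq n 2.
    have := modz_ge0 n (isT : 2 != 0 :> int); have := ltz_pmod n (isT : 0 < 2 :> int).
    by case: b {P} h; lia.
transitivity (\esum_(n in [set: int])
   (gauss (4 * L) ((w / L + 1 / 2) / 2 - (b : nat)%:R / 2) n)%:E)%E.
  apply: eq_esum => m _; congr EFin; rewrite /gauss; congr (expR (- _)).
  rewrite intrD intrM -[(Posz b)%:~R]/(b%:R) -[2%:~R]/(2%:R).
  by field; rewrite gt_eqF.
rewrite psiE //; case: b {P} => /=; congr EFin; congr psi; by field; rewrite gt_eqF.
Qed.

Let Q := expR (- (2 * L)).
Let Q0 : 0 < Q. Proof. exact: expR_gt0. Qed.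
Let Q1 : Q < 1. Proof. by rewrite expR_lt1 oppr_lt0 mulr_gt0. Qed.

Lemma natr_bin2 (j : nat) : 'C(j, 2)%:R = j%:R * (j%:R - 1) / 2 :> R.
Proof.
elim: j => [|j IH]; first by rewrite bin0n !mul0r.
by rewrite binS bin1 natrD IH -natr1; field.
Qed.

(** The [q]-binomial theorem centred at [N]: completing the square in the exponent
of the [j]-th term turns it into a Gaussian of [j - N]. *)
Lemma theta_prod_finite N w (e : R) :
  \prod_(i < N + N) (1 + e * expR (2 * (w - (i%:R - N%:R) * L))) =
  qbin Q (N + N) N * expR (L * (N%:R + 1 / 2 + w / L) ^+ 2) *
  \sum_(j < (N + N).+1) e ^+ j * (qweight Q N j * gauss L (w / L + 1 / 2) (j%:Z - N%:Z)).
Proof.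
have Ln0 : L != 0 by rewrite gt_eqF.
transitivity (\prod_(i < N + N) (1 + (e * expR (2 * w + 2 * N%:R * L)) * Q ^+ i)).
  apply: eq_bigr => i _; rewrite -expRM_natl -mulrA -expRD; congr (1 + _ * expR _).
  by ring.
rewrite qbinomial mulr_sumr; apply: eq_bigr => j _.
have bn0 : qbin Q (N + N) N != 0 by rewrite gt_eqF // qbin_gt0 // leq_addr.
rewrite /qweight /gauss exprMn -!expRM_natl.
transitivity (e ^+ j * qbin Q (N + N) j * (expR ('C(j, 2)%:R * - (2 * L)) * expR (j%:R * (2 * w + 2 * N%:R * L)))).
  by ring.
transitivity (e ^+ j * qbin Q (N + N) j * (expR (L * (N%:R + 1 / 2 + w / L) ^+ 2) * expR (- (L * ((j%:Z - N%:Z)%:~R - (w / L + 1 / 2)) ^+ 2)))); last by field.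
rewrite -!expRD; congr (_ * expR _).
rewrite intrD mulrNz -[(Posz j)%:~R]/(j%:R) -[(Posz N)%:~R]/(N%:R) natr_bin2.
by field.
Qed.

Lemma norm_tanhR w : `|tanhR w| = `|1 - expR (2 * w)| / (1 + expR (2 * w)).
Proof.
rewrite normrM normfV [X in _ / X]ger0_norm ?addr_ge0 ?expR_ge0 //.
by rewrite distrC [expR _ + 1]addrC.
Qed.

Local Open Scope classical_set_scope.

(** For [e = 1] and [e = -1] the finite triple product tends, after division by the
same normalisation and up to sign, to the plain and to the alternating theta series. *)
Lemma snq_prod w :
  (fun N : nat => \prod_(i < N + N) `|tanhR (w - (i%:R - N%:R) * L)|) @ \oo
    --> `|snq w|.
Proof.
pose S b N := \sum_(j < (N + N).+1)
  qweight Q N j * gauss_parity b (w / L + 1 / 2) (j%:Z - N%:Z).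
have cS b : S b @ \oo --> (if b then theta_odd w else theta_even w).
  apply: tannery_int => [n|//|N j|n|N j].
  - exact: gauss_parity_ge0.
  - exact: esum_gauss_parity.
  - exact: qweight_bounds.
  - exact: qweight_cvg.
  - exact: qweight_sym.
have Spos N : S false N + S true N =
    \sum_(j < (N + N).+1) 1 ^+ j * (qweight Q N j * gauss L (w / L + 1 / 2) (j%:Z - N%:Z)).
  rewrite -big_split /=; apply: eq_bigr => j _; rewrite expr1n -mulrDr /gauss_parity.
  by case: (odd _) => /=; rewrite ?addr0 ?add0r !mul1r.
have Sneg N : (-1) ^+ N * (S false N - S true N) =
    \sum_(j < (N + N).+1) (-1) ^+ j * (qweight Q N j * gauss L (w / L + 1 / 2) (j%:Z - N%:Z)).
  rewrite -sumrB mulr_sumr; apply: eq_bigr => j _.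
  rewrite -mulrBr /gauss_parity mulrCA [RHS]mulrCA; congr (_ * _).
  rewrite -signr_odd -[in RHS]signr_odd.
  have -> : odd j = odd N (+) odd `|j%:Z - N%:Z|%N by lia.
  by case: (odd N); case: (odd _) => /=; rewrite ?expr0 ?expr1; ring.
have E N : \prod_(i < N + N) `|tanhR (w - (i%:R - N%:R) * L)| =
    `|S true N - S false N| / (S true N + S false N).
  under eq_bigr do rewrite norm_tanhR; rewrite big_split /= prodfV -normr_prod.
  have hp := theta_prod_finite N w 1; have hm := theta_prod_finite N w (-1).
  rewrite -Spos in hp; rewrite -Sneg in hm.
  rewrite (eq_bigr (fun i : 'I_(N + N) => 1 + expR (2 * (w - (i%:R - N%:R) * L)))) in hp; last first.
    by move=> i _; rewrite mul1r.
  rewrite (eq_bigr (fun i : 'I_(N + N) => 1 - expR (2 * (w - (i%:R - N%:R) * L)))) in hm; last first.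
    by move=> i _; rewrite mulN1r.
  rewrite hm hp; set K := _ * expR _.
  have K0 : 0 < K by rewrite mulr_gt0 ?expR_gt0 // qbin_gt0 // leq_addr.
  move: K K0 => K K0; rewrite !normrM normrX normrN1 expr1n mul1r (gtr0_norm K0) distrC [X in _ = _ / X]addrC.
  by rewrite -mulf_div divff ?mul1r ?(gt_eqF K0).
rewrite (_ : (fun N => _) = (fun N => `|S true N - S false N| / (S true N + S false N))).
  have d0 : 0 < theta_odd w + theta_even w.
    by apply: addr_gt0; [exact: theta_odd_gt0|exact: theta_even_gt0].
  have -> : `|snq w| = `|theta_odd w - theta_even w| / (theta_odd w + theta_even w).
    by rewrite /snq normrM normfV (gtr0_norm d0).
  apply: cvgM; first by apply: cvg_norm; apply: cvgB; [exact: (cS true)|exact: (cS false)].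
  by apply: cvgV; rewrite ?gt_eqF //; apply: cvgD; [exact: (cS true)|exact: (cS false)].
exact/funext.
Qed.

Lemma snqN w : snq (- w) = - snq w.
Proof.
have e1 : theta_odd (- w) = theta_even w.
  by rewrite /theta_odd /theta_even -psiN; congr psi; field; rewrite gt_eqF.
have e2 : theta_even (- w) = theta_odd w.
  by rewrite /theta_odd /theta_even -psiN; congr psi; field; rewrite gt_eqF.
by rewrite /snq e1 e2 -mulNr opprB [X in _ / X]addrC.
Qed.

Lemma snqD w : snq (w + L) = - snq w.
Proof.
have e1 : theta_odd (w + L) = theta_even w.
  by rewrite /theta_odd /theta_even; congr psi; field; rewrite gt_eqF.
have e2 : theta_even (w + L) = theta_odd w.
  rewrite /theta_odd /theta_even -[in RHS]psiD1; congr psi; field; by rewrite gt_eqF.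
by rewrite /snq e1 e2 -mulNr opprB [X in _ / X]addrC.
Qed.

Lemma snq_norm_lt1 w : `|snq w| < 1.
Proof.
have e := theta_even_gt0 w; have o := theta_odd_gt0 w.
have d : 0 < theta_odd w + theta_even w by rewrite addr_gt0.
rewrite /snq normrM normfV [X in _ / X]gtr0_norm // ltr_pdivrMr // mul1r.
by rewrite ltr_norml; apply/andP; split; lra.
Qed.

(** Both [psi_mul] at [u + v, u - v] and its half-period translate express the
numerator and the denominator of the product as combinations of the same two
separated products. *)
Lemma snq_add_quotient : exists2 z : R -> R, forall u, 0 < z u &
  forall u v, snq (u + v) * snq (u - v) = (z u - z v) / (z u + z v).
Proof.
have L20 : 0 < 2 * L by rewrite mulr_gt0.
pose A u := psi (2 * L) (u / L); pose B u := psi (2 * L) (u / L + 1 / 2).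
have A0 u : 0 < A u by exact: psi_gt0.
have B0 u : 0 < B u by exact: psi_gt0.
exists (fun u => B u / A u) => [u|u v]; first exact: divr_gt0.
have L4E : 2 * (2 * L) = 4 * L by ring.
have h1 : B u * A v = theta_even (u + v) * theta_even (u - v) + theta_odd (u + v) * theta_odd (u - v).
  rewrite /B /A psi_mul // L4E /theta_even /theta_odd.
  by congr (psi _ _ * psi _ _ + psi _ _ * psi _ _); field; rewrite gt_eqF.
have h2 : A u * B v = theta_even (u + v) * theta_odd (u - v) + theta_odd (u + v) * theta_even (u - v).
  rewrite /B /A psi_mul // L4E /theta_even /theta_odd -[X in _ + _ * X]psiD1.
  by congr (psi _ _ * psi _ _ + psi _ _ * psi _ _); field; rewrite gt_eqF.
have -> : (B u / A u - B v / A v) / (B u / A u + B v / A v) =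
    (B u * A v - A u * B v) / (B u * A v + A u * B v).
  field; rewrite !gt_eqF ?A0 //=; by rewrite addr_gt0 // mulr_gt0.
rewrite h1 h2 /snq mulf_div; congr (_ / _); by ring.
Qed.

(** Setting [v = 0] in [snq_add_quotient] expresses the function [z] there through
[snq ^+ 2]. *)
Lemma snq_add u v :
  snq (u + v) * snq (u - v) * (1 - snq u ^+ 2 * snq v ^+ 2) = snq u ^+ 2 - snq v ^+ 2.
Proof.
have [z z0 hz] := snq_add_quotient.
have sq w : snq w ^+ 2 = (z w - z 0) / (z w + z 0).
  by rewrite -hz addr0 subr0 expr2.
rewrite hz !sq.
have p a b : z a + z b != 0 by rewrite gt_eqF // addr_gt0.
by field; rewrite !p.
Qed.

End ThetaQuotient.

(** * Periods, maximum and Landen inequality *)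

Section SnqBounds.
Variable R : realType.
Implicit Types (L d w u v x : R) (N k m : nat).
Local Open Scope classical_set_scope.

Lemma tanhR_norm_le1 w : `|tanhR w| <= 1.
Proof.
have h := expR_ge0 (2 * w); rewrite norm_tanhR ler_pdivrMr; last by lra.
by rewrite mul1r ler_norml; apply/andP; split; lra.
Qed.

Lemma tanhR_norm_le w : `|tanhR w| <= 2 * `|w|.
Proof.
rewrite norm_tanhR; have h := expR_gt0 (2 * w).
have d0 : 0 < 1 + expR (2 * w) by lra.
rewrite ler_pdivrMr //; case: (ltrP 0 w) => w0.
  rewrite (gtr0_norm w0) ler0_norm; last first.
    by have := expR_ge1Dx (2 * w); lra.
  have h2 := expR_ge1Dx (- (2 * w)).
  have h3 : expR (2 * w) * expR (- (2 * w)) = 1 by rewrite -expRD subrr expR0.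
  have : expR (2 * w) * (1 - 2 * w) <= 1 by rewrite -[leRHS]h3 ler_pM2l.
  lra.
rewrite (ler0_norm w0) ger0_norm; last by rewrite subr_ge0 expR_le1; lra.
have := expR_ge1Dx (2 * w); have : 0 <= expR (2 * w) * (- w) by rewrite mulr_ge0 //; lra.
lra.
Qed.

Lemma prod_ord_mul n m (F : nat -> R) :
  \prod_(i < n * m) F i = \prod_(i < n) \prod_(j < m) F (i * m + j)%N.
Proof.
elim: n => [|n IH]; first by rewrite !big_ord0.
rewrite big_ord_recr /= -IH; have -> : (n.+1 * m = n * m + m)%N by rewrite mulSn addnC.
by rewrite big_split_ord.
Qed.

Lemma cvg_prod_ord (f : nat -> nat -> R) (l : nat -> R) m :
  (forall j, (fun N => f j N) @ \oo --> l j) ->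
  (fun N => \prod_(j < m) f j N) @ \oo --> \prod_(j < m) l j.
Proof.
move=> h; elim: m => [|m IH].
  by under eq_fun do rewrite big_ord0; rewrite big_ord0; exact: cvg_cst.
by under eq_fun do rewrite big_ord_recr /=; rewrite big_ord_recr /=; exact: cvgM.
Qed.

(** The zeros of the factors on the right, spaced by [m * d], interlace to the
zeros of [snq d]; the finite products agree exactly. *)
Lemma snq_multisection d m w : 0 < d -> (0 < m)%N ->
  `|snq d w| = \prod_(j < m) `|snq (m%:R * d) (w - j%:R * d)|.
Proof.
move=> d0 m0; have md0 : 0 < m%:R * d by rewrite mulr_gt0 // ltr0n.
pose P e v N := \prod_(i < N + N) `|tanhR (v - (i%:R - N%:R) * e)|.
have c1 : (fun N => P d w (N * m)%N) @ \oo --> `|snq d w|.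
  apply: (@cvg_comp _ _ _ (fun N : nat => (N * m)%N) (P d w) \oo \oo).
    move=> A [M _ HM]; exists M => // N /= MN; apply: HM => /=.
    by apply: leq_trans MN _; rewrite leq_pmulr.
  exact: snq_prod.
have c2 : (fun N => \prod_(j < m) P (m%:R * d) (w - j%:R * d) N) @ \oo -->
    \prod_(j < m) `|snq (m%:R * d) (w - j%:R * d)|.
  apply: (@cvg_prod_ord (fun j => P (m%:R * d) (w - j%:R * d))
    (fun j => `|snq (m%:R * d) (w - j%:R * d)|)) => j; exact: snq_prod.
apply: (@norm_cvg_unique _ R^o _ _ _ _ c1); rewrite (_ : (fun N => _) =
  (fun N => \prod_(j < m) P (m%:R * d) (w - j%:R * d) N)) //.
apply/funext => N; rewrite /P exchange_big /= -mulnDl.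
rewrite (@prod_ord_mul _ _ (fun i => `|tanhR (w - (i%:R - (N * m)%:R) * d)|)).
apply: eq_bigr => i _; apply: eq_bigr => j _; congr `|tanhR _|.
by rewrite natrD !natrM; ring.
Qed.

Lemma snq_le_tanhR d w : 0 < d -> `|snq d w| <= `|tanhR w|.
Proof.
move=> d0; apply: (@cvgr_to_le _ _ _ R _ _ _ (@snq_prod R d d0 w)); exists 1%N => // N /= N1.
have NN : (N < N + N)%N by rewrite -addn1 leq_add2l.
rewrite (bigD1 (Ordinal NN)) //= subrr mul0r subr0 ler_piMr //.
by apply: prodr_ile1 => i _; rewrite normr_ge0 tanhR_norm_le1.
Qed.

Lemma snq0 d : 0 < d -> snq d 0 = 0.
Proof. by move=> d0; have := snqN d0 0; rewrite oppr0; lra. Qed.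

Lemma snq_sqr_lt1 d u : 0 < d -> snq d u ^+ 2 < 1.
Proof.
by move=> d0; rewrite -real_normK ?num_real // expr_lt1 // snq_norm_lt1.
Qed.

Lemma snq_sqrM_lt1 d u v : 0 < d -> 0 < 1 - snq d u ^+ 2 * snq d v ^+ 2 <= 1.
Proof.
move=> d0; rewrite gerBl mulr_ge0 ?sqr_ge0 // andbT subr_gt0.
have h1 := snq_sqr_lt1 u d0; have h2 := snq_sqr_lt1 v d0.
by apply: le_lt_trans h1; rewrite ler_piMr ?sqr_ge0 // ltW.
Qed.

(** The modulus [kappa], which is the maximum of [snq d ^+ 2]. *)
Definition snq_mod d : R := snq d (d / 2) ^+ 2.

(** By the addition formula at [v = d / 2], where [snq (u + v) = - snq (u - v)]. *)
Lemma snq_sqr_le_mod d u : 0 < d -> snq d u ^+ 2 <= snq_mod d.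
Proof.
move=> d0; rewrite -subr_le0 /snq_mod -snq_add //.
have -> : u + d / 2 = u - d / 2 + d by field.
rewrite snqD // mulNr -expr2 mulNr oppr_le0.
by rewrite mulr_ge0 ?sqr_ge0 // ltW //; have /andP[] := snq_sqrM_lt1 u (d / 2) d0.
Qed.

(** The addition formula bounds the increment of [snq ^+ 2] by [snq (u - v)], hence
by [tanh (u - v)]. *)
Lemma snq_sqr_continuous d : 0 < d -> continuous (fun u => snq d u ^+ 2).
Proof.
move=> d0 u; apply/cvgrPdist_le => e e0; near=> v.
rewrite -snq_add // normrM [X in _ * X]ger0_norm; last first.
  by rewrite ltW //; have /andP[] := snq_sqrM_lt1 u v d0.
apply: (@le_trans _ _ `|snq d (u - v)|).
  rewrite normrM -mulrA mulrC -mulrA; apply: ler_piMr => //.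
  apply: mulr_ile1; rewrite ?normr_ge0 ?(ltW (snq_norm_lt1 _ _)) //.
    by rewrite ltW //; have /andP[] := snq_sqrM_lt1 u v d0.
  by have /andP[] := snq_sqrM_lt1 u v d0.
apply: le_trans (snq_le_tanhR _ d0) _; apply: le_trans (tanhR_norm_le _) _.
rewrite mulrC -ler_pdivlMr //; near: v.
by apply: cvgr_dist_le; [exact: cvg_id|rewrite divr_gt0].
Unshelve. all: end_near. Qed.

Lemma snq_sqr_surj d X : 0 < d -> 0 <= X <= snq_mod d ->
  exists u, snq d u ^+ 2 = X.
Proof.
move=> d0 /andP[X0 X1].
have h : {within `[0, d / 2], continuous (fun u => snq d u ^+ 2)}.
  exact/continuous_subspaceT/snq_sqr_continuous.
have d2 : 0 <= d / 2 by rewrite divr_ge0 // ltW.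
have [|u _ <-] := @IVT R (fun u => snq d u ^+ 2) 0 (d / 2) X d2 h.
- by rewrite snq0 // expr0n /= min_l ?sqr_ge0 // max_r ?sqr_ge0 // X0.
- by exists u.
Qed.

(** With [X] and [Y] the values of [snq (2 * d) ^+ 2] at [d / 2] and [d], the addition
formula gives [Y = 2 * X / (1 + X ^+ 2)] while the multisection with two factors
gives [X ^+ 2 = snq_mod d]. *)
Lemma snq_mod_double d : 0 < d -> snq_mod (2 * d) ^+ 2 <= 4 * snq_mod d.
Proof.
move=> d0; have d20 : 0 < 2 * d by rewrite mulr_gt0.
set H := snq (2 * d).
have e1 : H (d + d / 2) = H (d / 2).
  by rewrite (_ : d + d / 2 = - (d / 2) + 2 * d); [rewrite /H snqD // snqN // opprK|field].
have e2 : d - d / 2 = d / 2 by field.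
have e3 : snq_mod (2 * d) = H d ^+ 2 by rewrite /snq_mod mulrAC divff ?mul1r // pnatr_eq0.
have hX : H d ^+ 2 <= 2 * H (d / 2) ^+ 2.
  have := snq_add d20 d (d / 2); rewrite -/H e1 e2 -expr2 => h.
  have : 0 <= (H (d / 2) ^+ 2) ^+ 2 * H d ^+ 2 by rewrite mulr_ge0 ?sqr_ge0.
  have e := expr2 (H (d / 2) ^+ 2).
  by move: h; rewrite e; lra.
have e4 : `|H (d / 2)| ^+ 2 = `|snq d (d / 2)|.
  rewrite (@snq_multisection d 2) // big_ord_recl big_ord1 -/H /= mul0r subr0 mul1r.
  by rewrite (_ : d / 2 - d = - (d / 2)); [rewrite /H snqN // normrN|field].
rewrite real_normK ?num_real // in e4.
rewrite e3 /snq_mod -[snq d _ ^+ 2]real_normK ?num_real // -e4.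
apply: (@le_trans _ _ ((2 * H (d / 2) ^+ 2) ^+ 2)).
  have q := sqr_ge0 (H (d / 2)); have q' := sqr_ge0 (H d).
  by rewrite ler_pXn2r ?nnegrE // mulr_ge0.
by rewrite le_eqVlt; apply/orP; left; apply/eqP; ring.
Qed.

(** Each [(n - 1 / 2) ^+ 2] is at least [1 / 4] plus the smaller of [n ^+ 2] and
[(n - 1) ^+ 2]. *)
Lemma psi_half_le L : 0 < L -> psi L (1 / 2) <= 2 * expR (- (L / 4)) * psi L 0.
Proof.
move=> L0; have e1 : psi L 1 = psi L 0 by rewrite -[X in psi L X = _]add0r psiD1.
have -> : 2 * expR (- (L / 4)) * psi L 0 =
   expR (- (L / 4)) * (psi L 0 + psi L 1) by rewrite e1; ring.
rewrite -lee_fin EFinM EFinD -!psiE // -esumD; last 2 first.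
- by move=> i _; exact: gauss_ge0.
- by move=> i _; exact: gauss_ge0.
rewrite -esumZl ?expR_ge0 //; last by move=> i; rewrite adde_ge0 ?gauss_ge0.
apply: le_esum => n _; rewrite -EFinD -EFinM lee_fin mulrDr /gauss -!expRD.
case: (lerP 1 n) => n1.
  apply: le_trans (_ : _ <= expR (- (L / 4) + - (L * (n%:~R - 1) ^+ 2))) _; last first.
    by rewrite lerDr expR_ge0.
  rewrite ler_expR -opprD lerN2.
  have : 1 <= n%:~R :> R by rewrite (ler_int _ 1 n).
  move: (n%:~R) => x x1; have : 0 <= L * (x - 1) by rewrite mulr_ge0 ?(ltW L0) ?subr_ge0.
  by rewrite !expr2; lra.
apply: le_trans (_ : _ <= expR (- (L / 4) + - (L * (n%:~R - 0) ^+ 2))) _; last first.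
  by rewrite lerDl expR_ge0.
rewrite ler_expR -opprD lerN2.
have : n%:~R <= 0 :> R by rewrite (ler_int _ n 0); lia.
move: (n%:~R) => x x1; have : 0 <= L * (- x) by rewrite mulr_ge0 ?(ltW L0) ?oppr_ge0.
by rewrite !expr2; lra.
Qed.

(** The complementary modulus [1 - kappa ^+ 2] is the fourth power of
[psi L (1 / 2) / psi L 0], by instances of [psi_mul] at the
arguments 0 and [1 / 2]. *)
Lemma snq_mod_ge L : 0 < L -> 1 - snq_mod L ^+ 2 <= 16 * expR (- L).
Proof.
move=> L0; pose f := psi (2 * L); have L20 : 0 < 2 * L by rewrite mulr_gt0.
have f0 : 0 < f 0 by exact: psi_gt0.
have f1 : 0 < f (1 / 2) by exact: psi_gt0.
pose a := theta_odd L (L / 2); pose b := theta_even L (L / 2).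
have Lr : L / 2 / L = 1 / 2 by field; rewrite gt_eqF.
have L4E : 2 * (2 * L) = 4 * L by ring.
have aE : a = psi (4 * L) 0 by rewrite /a /theta_odd Lr subrr mul0r.
have bE : b = psi (4 * L) (1 / 2).
  by rewrite /b /theta_even Lr (_ : (1 / 2 + 1 / 2) / 2 = 1 / 2) //; field.
have fN : psi (4 * L) (- (1 / 2)) = psi (4 * L) (1 / 2) by rewrite psiN.
have h1 : (1 / 2 + 1 / 2) / 2 = 1 / 2 :> R by field.
have h2 : (1 / 2 + 1 / 2 - 1) / 2 = 0 :> R by field.
have h3 : (0 - 1) / 2 = - (1 / 2) :> R by field.
have s1 : f 0 ^+ 2 = a ^+ 2 + b ^+ 2.
  by rewrite aE bE expr2 /f psi_mul // L4E subrr addr0 mul0r h3 fN !expr2.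
have s2 : f (1 / 2) ^+ 2 = 2 * (a * b).
  by rewrite aE bE expr2 /f psi_mul // L4E subrr mul0r h1 h2 h3 fN; ring.
have p1 : psi L (1 / 2) ^+ 2 = 2 * (f (1 / 2) * f 0).
  by rewrite expr2 psi_mul // subrr mul0r h1 h2 h3 psiN -/f; ring.
have p2 : psi L 0 ^+ 2 = f 0 ^+ 2 + f (1 / 2) ^+ 2.
  by rewrite expr2 psi_mul // subrr addr0 mul0r h3 psiN -/f; ring.
have P0 := psi_gt0 0 L0; have P1 := psi_gt0 (1 / 2) L0.
have tE : snq_mod L = (f 0 ^+ 2 - f (1 / 2) ^+ 2) / (f 0 ^+ 2 + f (1 / 2) ^+ 2).
  rewrite s1 s2 /snq_mod /snq -/a -/b exprMn exprVn.
  by congr (_ / _); ring.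
have -> : 1 - snq_mod L ^+ 2 = (psi L (1 / 2) / psi L 0) ^+ 4.
  have -> : (psi L (1 / 2) / psi L 0) ^+ 4 = (psi L (1 / 2) ^+ 2) ^+ 2 / (psi L 0 ^+ 2) ^+ 2.
    by field; rewrite gt_eqF.
  rewrite p1 p2 tE.
  by field; rewrite gt_eqF // addr_gt0 // exprn_gt0.
have e4 : expR (- L) = expR (- (L / 4)) ^+ 4.
  by rewrite -expRM_natl; congr expR; field.
have -> : 16 * expR (- L) = (2 * expR (- (L / 4))) ^+ 4 by rewrite e4 exprMn; ring.
rewrite ler_pXn2r ?nnegrE ?divr_ge0 ?mulr_ge0 ?expR_ge0 ?(ltW P0) ?(ltW P1) //.
by rewrite ler_pdivrMr // psi_half_le.
Qed.

End SnqBounds.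

(** * Sums of inverse odd squares *)

Section Decay.
Variable R : realType.
Implicit Types (x y d u : R) (N k m n M : nat).
Local Open Scope classical_set_scope.

Lemma derive_ge0_ge (f df : R -> R) y : 0 <= y ->
  (forall x, 0 <= x <= y -> is_derive x 1 f (df x)) ->
  (forall x, 0 <= x <= y -> 0 <= df x) -> f 0 <= f y.
Proof.
move=> y0 hf df0.
have sub x : x \in `]0, y[%R -> 0 <= x <= y.
  by rewrite in_itv /= => /andP[/ltW -> /ltW ->].
apply: (@ger0_derive1_le_cc R f 0 y) => //.
- by move=> x /sub/hf hx; exact: ex_derive.
- by move=> x /sub hx; have hx' := hf _ hx; rewrite derive1E derive_val df0.
- apply: derivable_within_continuous => x; rewrite in_itv /= => /hf hx; exact: ex_derive.
- by rewrite in_itv /= lexx y0.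
- by rewrite in_itv /= lexx y0.
Qed.

(** The right-hand exponent is a partial sum of the series of
[ln ((1 - y) / (1 + y))], all of whose terms are negative. *)
Lemma artanh_ge N y : 0 <= y -> y < 1 ->
  (1 - y) / (1 + y) <= expR (- (2 * \sum_(i < N) y ^+ i.*2.+1 / i.*2.+1%:R)).
Proof.
move=> y0 y1.
pose S x : R := \sum_(i < N) x ^+ i.*2.+1 / i.*2.+1%:R.
pose g x : R := ln (1 + x) - ln (1 - x) - 2 * S x.
have dS x : is_derive x 1 S (\sum_(i < N) x ^+ i.*2).
  rewrite /S; elim: N {S g} => [|m IH].
    rewrite big_ord0 (_ : (fun _ => _) = cst 0); first exact: is_derive_cst.
    by apply/funext => z; rewrite big_ord0.
  have dX : is_derive x 1 ((fun z : R => z) ^+ m.*2.+1) (m.*2.+1%:R * x ^+ m.*2).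
    by apply: is_derive_eq; rewrite /= /GRing.scale /= mulr1.
  rewrite big_ord_recr /= (_ : (fun z : R => _) =
    (fun z : R => \sum_(i < m) z ^+ i.*2.+1 / i.*2.+1%:R) +
    (m.*2.+1%:R^-1 \*: (fun z : R => z) ^+ m.*2.+1)).
    by apply: is_deriveD; apply: is_derive_eq; rewrite /GRing.scale /= mulrA mulVf ?mul1r ?pnatr_eq0.
  by apply/funext => z; rewrite big_ord_recr !fctE /= [_ / _]mulrC.
have dg x : 0 <= x <= y -> is_derive x 1 g (2 / (1 - x ^+ 2) - 2 * \sum_(i < N) x ^+ i.*2).
  move=> /andP[x1 x2].
  have p1 : 0 < 1 + x by lra.
  have p2 : 0 < 1 - x by lra.
  have d1 : is_derive x 1 (fun z : R => ln (1 + z)) (1 + x)^-1.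
    rewrite -[X in is_derive _ _ _ X]mulr1.
    apply: (@is_derive1_comp R (@ln R) (fun z => 1 + z)); first exact: is_derive1_ln.
    by apply: is_derive_eq; rewrite add0r mulr1.
  have d2 : is_derive x 1 (fun z : R => ln (1 - z)) (- (1 - x)^-1).
    rewrite -[X in is_derive _ _ _ X]mulrN1.
    apply: (@is_derive1_comp R (@ln R) (fun z => 1 - z)); first exact: is_derive1_ln.
    by apply: is_derive_eq; rewrite add0r mul1r.
  apply: is_derive_eq; rewrite /GRing.scale /= opprK; congr (_ - _).
  by field; rewrite !gt_eqF // (_ : 1 - x ^+ 2 = (1 - x) * (1 + x)) ?mulr_gt0 //; ring.
have dg0 x : 0 <= x <= y -> 0 <= 2 / (1 - x ^+ 2) - 2 * \sum_(i < N) x ^+ i.*2.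
  move=> /andP[x1 x2].
  have p : 0 < 1 - x ^+ 2.
    by rewrite (_ : 1 - x ^+ 2 = (1 - x) * (1 + x)); [rewrite mulr_gt0 //; lra|ring].
  rewrite subr_ge0 ler_pM2l // -[leRHS]mul1r ler_pdivlMr // mulrC.
  rewrite (eq_bigr (fun i : 'I_N => (x ^+ 2) ^+ i)); last first.
    by move=> i _; rewrite -exprM mul2n.
  have := subrX1 (x ^+ 2) N; have := exprn_ge0 N (sqr_ge0 x).
  by move: (\sum_(i < N) _) => T h1 h2; lra.
have := derive_ge0_ge y0 dg dg0.
have -> : g 0 = 0.
  rewrite /g subr0 addr0 ln1 subrr sub0r /S big1 ?mulr0 ?oppr0 // => i _.
  by rewrite expr0n mul0r.
rewrite /g -/(S y) => h.
have p1 : 0 < 1 + y by lra.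
have p2 : 0 < 1 - y by lra.
have -> : (1 - y) / (1 + y) = expR (ln (1 - y) - ln (1 + y)).
  by rewrite expRD expRN !lnK.
by rewrite ler_expR; lra.
Qed.

(** This is [cot x <= 1 / x] squared. *)
Lemma inv_sin_sqr_le x : 0 < x -> x < pi / 2 -> (sin x ^+ 2)^-1 <= (x ^+ 2)^-1 + 1.
Proof.
move=> x0 x1.
have s0 : 0 < sin x by apply: sin_gt0_pihalf; rewrite x0.
have c0 : 0 < cos x by apply: cos_gt0_pihalf; rewrite x1 andbT; have := @pi_gt0 R; lra.
have h : x * cos x <= sin x.
  rewrite -subr_ge0.
  have := @derive_ge0_ge (fun z => sin z - z * cos z) (fun z => z * sin z) x (ltW x0).
  rewrite sin0 mul0r subr0; apply.
    move=> z _; by apply: is_derive_eq; rewrite /GRing.scale /=; ring.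
  move=> z /andP[z0 z1]; rewrite mulr_ge0 // sin_ge0_pi // z0 /=; have := @pi_gt0 R; lra.
have h2 : cos x ^+ 2 / sin x ^+ 2 <= (x ^+ 2)^-1.
  rewrite ler_pdivrMr ?exprn_gt0 // mulrC ler_pdivlMr ?exprn_gt0 // mulrC -exprMn.
  have xc : 0 <= x * cos x by rewrite mulr_ge0 // ltW.
  by rewrite ler_pXn2r ?nnegrE ?(ltW s0).
have -> : (sin x ^+ 2)^-1 = cos x ^+ 2 / sin x ^+ 2 + 1.
  transitivity ((cos x ^+ 2 + sin x ^+ 2) / sin x ^+ 2); first by rewrite cos2Dsin2 mul1r.
  by rewrite mulrDl divff // sqrf_eq0 gt_eqF.
by rewrite lerD2r.
Qed.

Lemma inv_sin_sqr_double x : sin x != 0 -> cos x != 0 ->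
  (sin x ^+ 2)^-1 + (cos x ^+ 2)^-1 = 4 * (sin (2 * x) ^+ 2)^-1.
Proof.
move=> s0 c0; have -> : 2 * x = x *+ 2 by rewrite mulr_natl.
rewrite sin_mulr2n.
have -> : (sin x ^+ 2)^-1 + (cos x ^+ 2)^-1 = (cos x ^+ 2 + sin x ^+ 2) / (sin x ^+ 2 * cos x ^+ 2).
  by field; rewrite s0 c0.
by rewrite cos2Dsin2 -mulr_natl; field; rewrite s0 c0.
Qed.

(** Doubling the number of points replaces each term by the two halves of
[inv_sin_sqr_double], since [cos x = sin (pi / 2 - x)]. *)
Lemma sum_inv_sin_sqr n (N := (2 ^ n)%N) :
  \sum_(j < N) (sin (j.*2.+1%:R * pi / (4 * N%:R)) ^+ 2)^-1 = 2 * N%:R ^+ 2 :> R.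
Proof.
rewrite /N {N}; elim: n => [|n].
  rewrite expn0 big_ord1 /= double0 mul1r mulr1.
  have s2 : sin (pi / 4) ^+ 2 = 2^-1 :> R.
    have h1 := cos2Dsin2 (pi / 4 : R).
    have h2 : cos (pi / 4) = sin (pi / 4) :> R.
      have := sinB (pi / 2) (pi / 4 : R); rewrite sin_pihalf cos_pihalf mul1r mul0r subr0 => <-.
      by congr sin; field.
    by rewrite h2 in h1; lra.
  by rewrite s2 invrK expr1n mulr1.
set N := (2 ^ n)%N => IH.
have N0 : (0 < N)%N by rewrite expn_gt0.
have Nr : 0 < N%:R :> R by rewrite ltr0n.
have -> : (2 ^ n.+1 = N + N)%N by rewrite expnS mul2n addnn.
have pi0 := @pi_gt0 R.
rewrite big_split_ord /= [X in _ + X](reindex_inj rev_ord_inj) /= -big_split /=.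
rewrite natrD (_ : 2 * (N%:R + N%:R) ^+ 2 = 4 * (2 * N%:R ^+ 2)); last by ring.
rewrite -IH mulr_sumr; apply: eq_bigr => j _.
set x := j.*2.+1%:R * pi / (4 * (N%:R + N%:R)).
have jN : (j < N)%N by [].
have j0 : 0 < j.*2.+1%:R :> R by rewrite ltr0n.
have NN0 : 0 < 4 * (N%:R + N%:R) :> R by rewrite mulr_gt0 // addr_gt0.
have x0 : 0 < x by rewrite divr_gt0 // mulr_gt0.
have x1 : x < pi / 2.
  rewrite /x ltr_pdivrMr //.
  rewrite (_ : pi / 2 * _ = (4 * N%:R) * pi); last by field.
  rewrite ltr_pM2r // -(natrM _ 4) ltr_nat; lia.
have e1 : (N + (N - j.+1)).*2.+1%:R * pi / (4 * (N%:R + N%:R)) = pi / 2 - x.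
  have -> : (N + (N - j.+1)).*2.+1%:R = 4 * N%:R - j.*2.+1%:R :> R.
    by rewrite -natrM -natrB; [congr (_%:R); lia|lia].
  by rewrite /x; field; rewrite gt_eqF // addr_gt0.
rewrite e1 sinB sin_pihalf cos_pihalf mul1r mul0r subr0.
rewrite inv_sin_sqr_double ?gt_eqF //.
- by congr (4 * (sin _ ^+ 2)^-1); rewrite /x; field; rewrite !gt_eqF // addr_gt0.
- by apply: sin_gt0_pihalf; rewrite x0.
- by apply: cos_gt0_pihalf; rewrite x1 andbT; lra.
Qed.

Definition odd_basel N : R := \sum_(i < N) (i.*2.+1%:R ^+ 2)^-1.

(** The terms of [sum_inv_sin_sqr] exceed the inverse squares of their arguments
by at most 1. *)
Lemma odd_basel_ge n (N := (2 ^ n)%N) :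
  pi ^+ 2 / 8 * (1 - 1 / (2 * N%:R)) <= odd_basel N.
Proof.
have N0 : (0 < N)%N by rewrite expn_gt0.
have Nr : 0 < N%:R :> R by rewrite ltr0n.
have pi0 := @pi_gt0 R.
have h : 2 * N%:R ^+ 2 <= 16 * N%:R ^+ 2 / pi ^+ 2 * odd_basel N + N%:R.
  have NE : N%:R = \sum_(j < N) (1 : R) by rewrite sumr_const card_ord.
  rewrite [X in _ <= _ + X]NE -[X in X <= _](sum_inv_sin_sqr n) -/N /odd_basel mulr_sumr -big_split /=; apply: ler_sum => j _.
  have jN : (j < N)%N by [].
  have j0 : 0 < j.*2.+1%:R :> R by rewrite ltr0n.
  apply: le_trans (inv_sin_sqr_le _ _) _.
  - by rewrite divr_gt0 ?mulr_gt0.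
  - rewrite ltr_pdivrMr ?mulr_gt0 //.
    rewrite (_ : pi / 2 * _ = (2 * N%:R) * pi); last by field.
    rewrite ltr_pM2r // -(natrM _ 2) ltr_nat; lia.
  - rewrite lerD2r le_eqVlt; apply/orP; left; apply/eqP.
    move: (j.*2.+1%:R) (N%:R : R) (pi : R) j0 Nr pi0 => t w p t0 w0 p0; field.
    by rewrite !gt_eqF.
have p2 : 0 < pi ^+ 2 :> R by rewrite exprn_gt0.
rewrite -(ler_pM2l (_ : 0 < 16 * N%:R ^+ 2 / pi ^+ 2)); last first.
  by rewrite divr_gt0 ?mulr_gt0 ?exprn_gt0.
apply: (@le_trans _ _ (2 * N%:R ^+ 2 - N%:R)); last by rewrite lerBlDr.
rewrite le_eqVlt; apply/orP; left; apply/eqP.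
by move: (N%:R : R) (pi : R) Nr pi0 => w p w0 p0; field; rewrite !gt_eqF.
Qed.

End Decay.

(** * Decay of the modulus and the Zolotarev problem *)

Section Zolotarev.
Variable R : realType.
Implicit Types (x y d u X L : R) (N k m n M : nat).
Local Open Scope classical_set_scope.

Lemma tanhRN x : tanhR (- x) = - tanhR x.
Proof.
rewrite /tanhR mulrN expRN; have := expR_gt0 (2 * x); move: (expR _) => E E0.
by field; rewrite !gt_eqF // addr_gt0.
Qed.

Lemma tanhR_norm_ge0 x : 0 <= x ->
  `|tanhR x| = (1 - expR (- (2 * x))) / (1 + expR (- (2 * x))).
Proof.
move=> x0; rewrite -normrN -tanhRN norm_tanhR mulrN ger0_norm //.
by rewrite subr_ge0 expR_le1 oppr_le0 mulr_ge0.
Qed.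

(** At [- (d / 2)] the zeros of the finite products are placed symmetrically, so that
the factors agree in pairs. *)
Lemma snq_half_prod d : 0 < d ->
  (fun M : nat => (\prod_(k < M) `|tanhR ((k%:R + 1 / 2) * d)|) ^+ 2) @ \oo --> `|snq d (d / 2)|.
Proof.
move=> d0; rewrite -normrN -snqN //.
have := @snq_prod R d d0 (- (d / 2)).
rewrite (_ : (fun N => _) = (fun M : nat => (\prod_(k < M) `|tanhR ((k%:R + 1 / 2) * d)|) ^+ 2)) //.
apply/funext => N; rewrite big_split_ord /= (reindex_inj rev_ord_inj) /= expr2; congr (_ * _).
  apply: eq_bigr => k _; congr `|tanhR _|; rewrite natrB // -natr1; by field.
by apply: eq_bigr => k _; rewrite -normrN -tanhRN; congr `|tanhR _|; rewrite natrD; field.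
Qed.

(** The common ratio is at least [1 - 2 * c * d]. *)
Lemma geometric_odd_ge c d M : 0 < c -> 0 < d ->
  expR (- (c * d)) * (1 - expR (- (2 * c * d)) ^+ M) / (2 * c * d) <=
  \sum_(k < M) expR (- (2 * ((k%:R + 1 / 2) * d))) `^ c.
Proof.
move=> c0 d0; rewrite (eq_bigr (fun k : 'I_M => expR (- (c * d)) * expR (- (2 * c * d)) ^+ k)).
  rewrite -mulr_sumr -mulrA ler_pM2l ?expR_gt0 //.
  have cd : 0 < 2 * c * d by rewrite !mulr_gt0.
  rewrite ler_pdivrMr //; have := subrX1 (expR (- (2 * c * d))) M.
  have S0 : 0 <= \sum_(i < M) expR (- (2 * c * d)) ^+ i.
    by apply: sumr_ge0 => i _; rewrite exprn_ge0 ?expR_ge0.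
  have h := expR_ge1Dx (- (2 * c * d)).
  have : (1 - expR (- (2 * c * d))) * \sum_(i < M) expR (- (2 * c * d)) ^+ i
    <= (2 * c * d) * \sum_(i < M) expR (- (2 * c * d)) ^+ i.
    by apply: ler_wpM2r => //; lra.
  move: S0; move: (\sum_(i < M) _) => S S0; lra.
move=> k _; rewrite -expRM -expRM_natl -expRD; congr expR; by field.
Qed.

(** Bounding each [tanh] of the product by [artanh_ge] and summing over the factors
first gives geometric series, which are estimated by [geometric_odd_ge]. *)
Lemma snq_half_le d N : 0 < d ->
  `|snq d (d / 2)| <= expR (- (2 / d * (expR (- (2 * N%:R * d)) * odd_basel R N))).
Proof.
move=> d0; pose eta := expR (- (2 * d)).
have eta1 : `|eta| < 1 by rewrite ger0_norm ?expR_ge0 // expR_lt1 oppr_lt0 mulr_gt0.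
pose K := 2 / d * (expR (- (2 * N%:R * d)) * odd_basel R N).
have B0 : 0 <= odd_basel R N by apply: sumr_ge0 => i _; rewrite invr_ge0 exprn_ge0.
have c1 : (fun M : nat => expR (- (K * (1 - eta ^+ M)))) @ \oo --> expR (- (K * (1 - 0))).
  apply: (@continuous_cvg _ _ _ _ _ _ (@expR R)); first exact: continuous_expR.
  apply: cvgN; apply: cvgM; first exact: cvg_cst.
  by apply: cvgB; [exact: cvg_cst|exact: cvg_expr].
rewrite subr0 mulr1 in c1.
apply: (ler_cvg_to (snq_half_prod d0) c1); apply: nearW => M.
have hk (k : 'I_M) : 0 <= 2 * ((k%:R + 1 / 2) * d) by rewrite !mulr_ge0 ?addr_ge0 ?divr_ge0 // ltW.
pose y (k : nat) := expR (- (2 * ((k%:R + 1 / 2) * d))).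
have h1 : \prod_(k < M) `|tanhR ((k%:R + 1 / 2) * d)| <=
    expR (\sum_(k < M) - (2 * \sum_(i < N) y k ^+ i.*2.+1 / i.*2.+1%:R)).
  rewrite expR_sum; apply: ler_prod => k _; rewrite normr_ge0 /=.
  rewrite tanhR_norm_ge0; last by have := hk k; lra.
  apply: artanh_ge; first exact: expR_ge0.
  by rewrite expR_lt1 oppr_lt0 !mulr_gt0 // ltr_wpDl.
have p0 : 0 <= \prod_(k < M) `|tanhR ((k%:R + 1 / 2) * d)| by apply: prodr_ge0.
apply: (@le_trans _ _ (expR (\sum_(k < M) - (2 * \sum_(i < N) y k ^+ i.*2.+1 / i.*2.+1%:R)) ^+ 2)).
  by rewrite ler_pXn2r ?nnegrE ?expR_ge0.
rewrite -expRM_natl ler_expR sumrN mulrN lerN2 -mulr_sumr exchange_big /=.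
have -> : K * (1 - eta ^+ M) = 2 * (2 * \sum_(i < N)
   (expR (- (2 * N%:R * d)) * (1 - eta ^+ M) / (2 * i.*2.+1%:R * d)) / i.*2.+1%:R).
  rewrite /K /odd_basel !mulr_sumr mulr_suml; apply: eq_bigr => i _.
  have : 0 < i.*2.+1%:R :> R by rewrite ltr0n.
  by move: (i.*2.+1%:R) => t t0; field; rewrite !gt_eqF.
rewrite !ler_pM2l //; apply: ler_sum => i _; rewrite -mulr_suml.
have l0 : 0 < i.*2.+1%:R :> R by rewrite ltr0n.
have l1 : 1 <= i.*2.+1%:R :> R by rewrite ler1n.
rewrite ler_pM2r ?invr_gt0 //.
rewrite (eq_bigr (fun k : 'I_M => y k `^ i.*2.+1%:R)); last first.
  by move=> k _; rewrite powR_mulrn // expR_ge0.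
apply: le_trans (geometric_odd_ge M l0 d0).
rewrite ler_pM2r ?invr_gt0 ?mulr_gt0 //; apply: ler_pM; rewrite ?expR_ge0 //.
- by rewrite subr_ge0 exprn_ile1 ?expR_ge0 // ltW // -[ltLHS]ger0_norm ?expR_ge0.
- rewrite ler_expR lerN2 ler_pM2r // -natrM ler_nat; have := ltn_ord i; lia.
rewrite lerD2l lerN2; apply: lerXn2r; rewrite ?nnegrE ?expR_ge0 // /eta ler_expR lerN2.
by rewrite ler_pM2r // ler_peMr.
Qed.

(** Landen's inequality reads [(snq_mod (2 * d) / 4) ^+ 2 <= snq_mod d / 4]. *)
Lemma snq_mod_iter m d : 0 < d ->
  (snq_mod d / 4) ^+ (2 ^ m) <= snq_mod (d / (2 ^ m)%:R) / 4.
Proof.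
elim: m d => [|m IH] d d0; first by rewrite expn0 expr1 divr1.
have d20 : 0 < d / 2 by rewrite divr_gt0.
rewrite expnS exprM natrM invfM mulrA.
apply: le_trans (IH _ d20); apply: lerXn2r; rewrite ?nnegrE ?sqr_ge0 ?divr_ge0 ?sqr_ge0 //.
have := snq_mod_double d20; rewrite mulrCA divff ?mulr1 //.
by move: (snq_mod d) (snq_mod (d / 2)) => a b; rewrite !expr2 => h; lra.
Qed.

(** The step [d] is halved [2 * n] times and [2 ^ n] terms are kept in the sum of
inverse odd squares, so that both relative errors are of order [1 / 2 ^ n]. *)
Lemma snq_mod_le d : 0 < d -> snq_mod d <= 4 * expR (- (pi ^+ 2 / (2 * d))).
Proof.
move=> d0; rewrite mulrC -ler_pdivrMr //.
pose c := 2 * d + 1 / 2; pose A : R := pi ^+ 2 / (2 * d).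
have A0 : 0 < A by rewrite divr_gt0 ?exprn_gt0 ?pi_gt0 ?mulr_gt0.
have c1 : (fun n : nat => expR (- (A * (1 - c * 2^-1 ^+ n)))) @ \oo --> expR (- (A * (1 - c * 0))).
  apply: (@continuous_cvg _ _ _ _ _ _ (@expR R)); first exact: continuous_expR.
  apply: cvgN; apply: cvgM; first exact: cvg_cst.
  apply: cvgB; first exact: cvg_cst; apply: cvgM; first exact: cvg_cst.
  by apply: cvg_expr; rewrite ger0_norm // invf_lt1 // ltr1n.
rewrite mulr0 subr0 mulr1 in c1; apply: (cvgr_to_ge c1); apply: nearW => n.
set N := (2 ^ n)%N; have N0 : (0 < N)%N by rewrite expn_gt0.
have Nr : 0 < N%:R :> R by rewrite ltr0n.
have Nr1 : 1 <= N%:R :> R by rewrite ler1n.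
have -> : 2^-1 ^+ n = N%:R^-1 :> R by rewrite exprVn natrX.
pose K := (2 ^ (n + n))%N; have KE : K%:R = N%:R * N%:R :> R by rewrite /K expnD natrM.
have K0 : (0 < K)%N by rewrite expn_gt0.
have Kr : 0 < K%:R :> R by rewrite ltr0n.
have dK : 0 < d / K%:R by rewrite divr_gt0.
have t0 : 0 <= snq_mod d / 4 by rewrite divr_ge0 ?sqr_ge0.
rewrite -(ler_pXn2r K0) ?nnegrE ?expR_ge0 //.
apply: (le_trans (snq_mod_iter (n + n) d0)); rewrite -/K.
apply: (@le_trans _ _ (snq_mod (d / K%:R))).
  by rewrite ler_pdivrMr // ler_peMr ?sqr_ge0 // ler1n.
have h := snq_half_le N dK.
apply: (@le_trans _ _ (expR (- (2 / (d / K%:R) * (expR (- (2 * N%:R * (d / K%:R))) * odd_basel R N))) ^+ 2)).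
  rewrite /snq_mod -real_normK ?num_real //.
  by rewrite ler_pXn2r ?nnegrE ?expR_ge0.
rewrite -!expRM_natl ler_expR !mulrN lerN2.
have -> : 2 * (2 / (d / K%:R) * (expR (- (2 * N%:R * (d / K%:R))) * odd_basel R N)) =
  K%:R * (4 / d * (expR (- (2 * N%:R * (d / K%:R))) * odd_basel R N)).
  by field; rewrite !gt_eqF.
rewrite ler_pM2l //.
have -> : A * (1 - c / N%:R) = 4 / d * ((1 - 2 * d / N%:R - 1 / (2 * N%:R)) * (pi ^+ 2 / 8)).
  rewrite /A /c; move: (N%:R) (pi : R) Nr => w p w0; by field; rewrite !gt_eqF.
rewrite ler_pM2l ?divr_gt0 //.
have xE : 2 * N%:R * (d / K%:R) = 2 * d / N%:R by rewrite KE; field; rewrite gt_eqF.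
rewrite xE; set x := 2 * d / N%:R; set z := 1 / (2 * N%:R).
have x0 : 0 <= x by rewrite divr_ge0 ?mulr_ge0 // ltW.
have z0 : 0 <= z by rewrite divr_ge0 ?mulr_ge0 // ltW.
have z1 : z <= 1 by rewrite ler_pdivrMr ?mulr_gt0 //; lra.
have B := odd_basel_ge R n; rewrite -/N -/z in B.
apply: (@le_trans _ _ (expR (- x) * (pi ^+ 2 / 8 * (1 - z)))); last first.
  by rewrite ler_pM2l ?expR_gt0.
rewrite [leRHS]mulrCA [leRHS]mulrC ler_pM2r ?divr_gt0 ?exprn_gt0 ?pi_gt0 //.
have := expR_ge1Dx (- x) => h2.
have : (1 - x) * (1 - z) <= expR (- x) * (1 - z) by apply: ler_wpM2r; lra.
have : 0 <= x * z by rewrite mulr_ge0.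
lra.
Qed.

(** The zeros are the values at [(j + 1 / 2) * d], where [2 * k * d = L].  By the
addition formula the [j]-th factor at [snq L u ^+ 2] is the product of the values
of [snq L] at the two translates of [u] by this point, and the [2 * k]
translates are equally spaced modulo [L]. *)
Lemma zolotarev L k : 0 < L -> (0 < k)%N ->
  exists2 xi : nat -> R, forall j, 0 <= xi j < 1 &
    forall X, 0 <= X <= snq_mod L ->
      (\prod_(j < k) ((X - xi j) / (1 - xi j * X))) ^+ 2 <=
        4 * expR (- (pi ^+ 2 * k%:R / L)).
Proof.
move=> L0 k0; have kr : 0 < k%:R :> R by rewrite ltr0n.
pose d := L / (2 * k%:R); have d0 : 0 < d by rewrite divr_gt0 ?mulr_gt0.
pose v (j : nat) := (j%:R + 1 / 2) * d.
exists (fun j => snq L (v j) ^+ 2) => [j|X /(snq_sqr_surj L0)[u <-]].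
  by rewrite sqr_ge0 snq_sqr_lt1.
rewrite -real_normK ?num_real // normr_prod.
have -> : \prod_(j < k) `|(snq L u ^+ 2 - snq L (v j) ^+ 2) / (1 - snq L (v j) ^+ 2 * snq L u ^+ 2)|
    = `|snq d (u + (k%:R - 1 / 2) * d)|.
  rewrite (@snq_multisection _ d (k + k)) ?addn_gt0 ?k0 // big_split_ord /=.
  rewrite [X in _ = X * _](reindex_inj rev_ord_inj) /= -big_split /=; apply: eq_bigr => j _.
  have -> : (k + k)%:R * d = L by rewrite /d natrD; field; rewrite gt_eqF.
  have /andP[p _] := snq_sqrM_lt1 u (v j) L0.
  rewrite [_ ^+ 2 * snq L u ^+ 2]mulrC -snq_add // mulfK ?gt_eqF // normrM.
  congr (`|snq L _| * `|snq L _|); rewrite /v.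
    by rewrite natrB // -natr1; field.
  by rewrite natrD; field.
rewrite real_normK ?num_real //; apply: (le_trans (snq_sqr_le_mod _ d0)).
apply: (le_trans (snq_mod_le d0)); rewrite le_eqVlt; apply/orP; left; apply/eqP.
congr (_ * expR (- _)); rewrite /d; move: (pi : R) => p.
by field; rewrite !gt_eqF.
Qed.

End Zolotarev.

(** * Singular values and low-rank perturbations *)

Section SingularValues.
Local Open Scope sesquilinear_scope.
Variable R : realType.
Local Notation C := R[i].
Implicit Types (n m : nat).

(** The squared Euclidean norm. *)
Definition sqnorm n (v : 'cV[C]_n) : C := \sum_i `|v i 0| ^+ 2.

Lemma sqnormE n (v : 'cV[C]_n) : sqnorm v = (v ^t* *m v) 0 0.
Proof. by rewrite mxE; apply: eq_bigr => i _; rewrite !mxE normCKC. Qed.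

Lemma sqnorm_gt0 n (v : 'cV[C]_n) : v != 0 -> 0 < sqnorm v.
Proof.
move=> /cV0Pn[i vi]; rewrite /sqnorm (bigD1 i) //=.
rewrite ltr_pwDl ?exprn_gt0 ?normr_gt0 //.
by apply: sumr_ge0 => j _; rewrite exprn_ge0.
Qed.

Lemma sqnorm_unitary n (U : 'M[C]_n) (v : 'cV[C]_n) :
  U \is unitarymx -> sqnorm (U *m v) = sqnorm v.
Proof.
move=> Uu; rewrite !sqnormE trmx_mul map_mxM mulmxA -[_ *m _ *m U]mulmxA.
have -> : U ^t* *m U = 1%:M by rewrite -invmx_unitary // mulVmx // unitarymx_unit.
by rewrite mulmx1.
Qed.

Lemma sqnorm_diag n (f : 'I_n -> R) (M : R) (v : 'cV[C]_n) :
  (forall i, `|f i| <= M) ->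
  sqnorm (diag_mx (\row_i (f i)%:C) *m v) <= (M ^+ 2)%:C * sqnorm v.
Proof.
move=> fM; rewrite /sqnorm mulr_sumr; apply: ler_sum => i _.
rewrite mul_diag_mx !mxE normrM exprMn; apply: ler_wpM2r; first by rewrite exprn_ge0.
rewrite normc_def /= expr0n addr0 sqrtr_sqr -rmorphXn lecR /=.
by rewrite lerXn2r ?nnegrE // (le_trans _ (fM i)).
Qed.

Lemma spectral_diag_sqrt n (X : 'M[C]_n) j :
  spectral_diag (X ^t* *m X) 0 j =
  (Num.sqrt (complex.Re (spectral_diag (X ^t* *m X) 0 j)) ^+ 2)%:C.
Proof.
have [_ _ /(_ j)] := gram_spectral X; set z := spectral_diag _ 0 j.
case: z => a b; rewrite lecE /= => /andP[/eqP -> a0].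
by rewrite sqr_sqrtr.
Qed.

Lemma sqnorm_spectral n (X : 'M[C]_n) (v : 'cV[C]_n) :
  sqnorm (X *m v) =
  \sum_j spectral_diag (X ^t* *m X) 0 j * `|(spectralmx (X ^t* *m X) *m v) j 0| ^+ 2.
Proof.
have [_ GE _] := gram_spectral X.
move: (spectral_diag _) (spectralmx _) GE => D U GE.
rewrite sqnormE trmx_mul map_mxM mulmxA -[_ *m _ *m X]mulmxA GE.
rewrite !mulmxA -[_ *m U *m v]mulmxA.
have -> : v ^t* *m U ^t* = (U *m v) ^t* by rewrite trmx_mul map_mxM.
move: (U *m v) => w.
rewrite -mulmxA mul_diag_mx mxE; apply: eq_bigr => j _.
by rewrite !mxE normCKC mulrCA.
Qed.

Lemma sqnorm_le_norm2 n (X : 'M[C]_n) (v : 'cV[C]_n) :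
  sqnorm (X *m v) <= (norm2 X ^+ 2)%:C * sqnorm v.
Proof.
have [Uu _ _] := gram_spectral X.
rewrite sqnorm_spectral -(sqnorm_unitary v Uu) /sqnorm mulr_sumr.
apply: ler_sum => j _; apply: ler_wpM2r; first by rewrite exprn_ge0.
rewrite spectral_diag_sqrt lecR lerXn2r ?nnegrE ?sqrtr_ge0 ?sigma_ge0 //.
set a := Num.sqrt _.
have al : a \in singular_values X.
  by rewrite /singular_values mem_sort; apply/mapP; exists j; rewrite ?mem_enum.
have := sigma_nonincreasing X (leq_addr (index a (singular_values X)) 1).
by rewrite /norm2 {1}/sigma /= nth_index.
Qed.

(** The span of the right singular vectors whose singular value is at least
[sigma X m.+1] has dimension greater than [m], so it meets the kernel of [Y] in a
nonzero vector, on which [X] and [W] coincide. *)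
Lemma sigma_le_rank n m (X Y W : 'M[C]_n) (c : R) :
  X = Y + W -> (\rank Y <= m)%N -> 0 <= c ->
  (forall v : 'cV[C]_n, sqnorm (W *m v) <= (c ^+ 2)%:C * sqnorm v) ->
  sigma X m.+1 <= c.
Proof.
move=> XE rY c0 hW; case: (leqP n m) => [nm|mn].
  by rewrite sigma_default.
have [Uu _ _] := gram_spectral X.
set U := spectralmx _ in Uu; set s := sigma X m.+1.
have s0 : 0 <= s by exact: sigma_ge0.
pose f (j : 'I_n) : R := Num.sqrt (complex.Re (spectral_diag (X ^t* *m X) 0 j)).
pose J := [set j : 'I_n | s <= f j].
have Jm : (m < #|J|)%N.
  have -> : #|J| = count (fun t => s <= t) (singular_values X).
    rewrite /singular_values (seq.permP (permEl (perm_sort _ _))) count_map.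
    rewrite -sum1_count big_enum_cond /= -sum1_card.
    by apply: eq_bigl => j /=; rewrite inE.
  rewrite -(cat_take_drop m.+1 (singular_values X)) count_cat.
  apply: leq_trans (leq_addr _ _).
  have sz : size (take m.+1 (singular_values X)) = m.+1.
    by rewrite size_take_min size_singular_values (minn_idPl _).
  have : all (fun t => s <= t) (take m.+1 (singular_values X)); last first.
    by rewrite all_count sz => /eqP ->.
  apply/(all_nthP 0) => i.
  rewrite sz ltnS => im; rewrite nth_take ?ltnS //.
  exact: (sigma_nonincreasing X (im : (i.+1 <= m.+1)%N)).
pose S : 'M[C]_(n, #|J|) := \matrix_(i, j) (i == enum_val j)%:R.
pose B := Y *m U ^t* *m S.
have /rowV0Pn[z zker z0] : kermx B^T != 0.
  rewrite -mxrank_eq0 mxrank_ker mxrank_tr -lt0n subn_gt0.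
  apply: leq_ltn_trans Jm; apply: leq_trans rY.
  by rewrite /B -mulmxA mxrankM_maxl.
have zB : z *m B^T = 0 by apply/eqP; rewrite -sub_kermx.
pose w := S *m z^T; pose v := U ^t* *m w.
have wE j : w (enum_val j) 0 = z 0 j.
  rewrite mxE (bigD1 j) //= !mxE eqxx mul1r big1 ?addr0 // => k kj.
  by rewrite !mxE (inj_eq enum_val_inj) eq_sym (negPf kj) mul0r.
have w0 : w != 0.
  have /rV0Pn[j zj] := z0; apply/cV0Pn; exists (enum_val j); by rewrite wE.
have wJ i : i \notin J -> w i 0 = 0.
  move=> iJ; rewrite mxE big1 // => j _; rewrite !mxE.
  by case: eqP iJ => [->|_ _]; rewrite ?enum_valP ?mul0r.
have Yv : Y *m v = 0.
  by rewrite /v mulmxA /w mulmxA -/B -[B]trmxK -trmx_mul zB trmx0.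
have Uv : U *m v = w by rewrite /v mulmxA (unitarymxP Uu) mul1mx.
have Xv : X *m v = W *m v by rewrite XE mulmxDl Yv add0r.
have vw : sqnorm w = sqnorm v by rewrite -(sqnorm_unitary v Uu) Uv.
have h1 : (s ^+ 2)%:C * sqnorm w <= sqnorm (X *m v).
  rewrite sqnorm_spectral -/U Uv /sqnorm mulr_sumr; apply: ler_sum => j _.
  have [jJ|jJ] := boolP (j \in J); last by rewrite wJ // normr0 expr0n !mulr0.
  apply: ler_wpM2r; first by rewrite exprn_ge0.
  rewrite spectral_diag_sqrt lecR lerXn2r ?nnegrE ?sqrtr_ge0 //.
  by move: jJ; rewrite inE.
have := le_trans h1 (_ : _ <= (c ^+ 2)%:C * sqnorm w).
rewrite Xv vw => /(_ (hW v)); rewrite -vw ler_pM2r ?sqnorm_gt0 // lecR.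
by rewrite ler_pXn2r.
Qed.

End SingularValues.

(** * Displacement structure of Loewner matrices *)

Section Displacement.
Variable R : realType.
Local Notation C := R[i].
Implicit Types (k : nat).

Definition blaschke (xi t : R) : R := (t - xi) / (1 - xi * t).

Lemma blaschke_den (xi t : R) : 0 <= xi < 1 -> 0 <= t < 1 -> 0 < 1 - xi * t.
Proof.
move=> /andP[x0 x1] /andP[t0 t1]; rewrite subr_gt0.
by apply: le_lt_trans x1; rewrite ler_piMr // ltW.
Qed.

Lemma blaschke_sub (xi s t : R) : 0 <= xi < 1 -> 0 <= s < 1 -> 0 <= t < 1 ->
  1 - blaschke xi s * blaschke xi t =
  (1 - xi ^+ 2) * (1 - s * t) / ((1 - xi * s) * (1 - xi * t)).
Proof.
move=> hx hs ht; rewrite /blaschke.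
have := blaschke_den hx hs; have := blaschke_den hx ht => h1 h2.
by field; rewrite !gt_eqF.
Qed.

(** The factor [x j - y l] cancels the denominator of the Loewner entry, and
[r j - s l] times a separated function is a sum of two separated functions. *)
Lemma rank_displacement_step (n : nat) (x y : 'I_n -> R) (r s : 'cV[C]_n)
    (f g F G : 'I_n -> R) :
  (forall j l, x j != y l) ->
  (\rank (\matrix_(j, l) (loewner x y r s j l *
     (F j * G l * (f j * g l * (x j - y l)))%:C))%R <= 2)%N.
Proof.
move=> xy; set M := \matrix_(j, l) _.
pose c1 : 'cV[C]_n := \col_j (r j 0 * (F j * f j)%:C).
pose r1 : 'rV[C]_n := \row_l (G l * g l)%:C.
pose c2 : 'cV[C]_n := \col_j (F j * f j)%:C.
pose r2 : 'rV[C]_n := \row_l (- s l 0 * (G l * g l)%:C).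
have -> : M = c1 *m r1 + c2 *m r2.
  apply/matrixP => j l; rewrite !mxE !big_ord1 !mxE.
  have h : (x j - y l)%:C != 0 :> C.
    by rewrite (fmorph_eq0 (real_complex R)) subr_eq0.
  rewrite !rmorphM /=; move: ((x j - y l)%:C) h => d d0; by field.
apply: leq_trans (mxrank_add _ _) _; apply: (@leq_add _ _ 1 1).
  by apply: leq_trans (mxrankM_maxr _ _) _; exact: rank_leq_row.
by apply: leq_trans (mxrankM_maxr _ _) _; exact: rank_leq_row.
Qed.

Section Split.
Variables (n : nat) (x y : 'I_n -> R) (r s : 'cV[C]_n).
Variables (a b al be : 'I_n -> R) (xi : nat -> R).
Hypothesis xy : forall j l, x j != y l.
Hypotheses (a01 : forall j, 0 <= a j < 1) (b01 : forall l, 0 <= b l < 1).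
Hypothesis xi01 : forall i, 0 <= xi i < 1.
Hypothesis sep : forall j l, 1 - a j * b l = al j * be l * (x j - y l).

Definition bprod k (t : R) : R := \prod_(i < k) blaschke (xi i) t.

(** Passing from [k] to [k + 1] Blaschke factors is one [rank_displacement_step]. *)
Lemma rank_loewner_split k :
  (\rank (loewner x y r s -
     \matrix_(j, l) (loewner x y r s j l * (bprod k (a j) * bprod k (b l))%:C))%R
   <= 2 * k)%N.
Proof.
elim: k => [|k IH].
  rewrite (_ : _ - _ = 0) ?mxrank0 //; apply/matrixP => j l.
  by rewrite !mxE /bprod !big_ord0 !mulr1 subrr.
pose f j := (1 - xi k ^+ 2) * al j / (1 - xi k * a j).
pose g l := be l / (1 - xi k * b l).
have hs := @rank_displacement_step n x y r s f g
  (fun j => bprod k (a j)) (fun l => bprod k (b l)) xy.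
rewrite mulnS addnC; apply: leq_trans (leq_add IH hs).
apply: leq_trans (mxrank_add _ _); apply: eq_leq; congr (\rank _).
move: (loewner x y r s) => Lw; apply/matrixP => j l; rewrite !mxE -addrA; congr (_ + _).
have -> : f j * g l * (x j - y l) = 1 - blaschke (xi k) (a j) * blaschke (xi k) (b l).
  rewrite blaschke_sub // sep /f /g.
  have := blaschke_den (xi01 k) (a01 j); have := blaschke_den (xi01 k) (b01 l) => h1 h2.
  by field; rewrite !gt_eqF.
set t := blaschke _ _ * blaschke _ _; set P := bprod k (a j) * bprod k (b l).
have -> : bprod k.+1 (a j) * bprod k.+1 (b l) = P - P * (1 - t).
  by rewrite /bprod !big_ord_recr /=; rewrite /P /t /bprod; ring.
by rewrite rmorphB /=; ring.
Qed.

Lemma sigma_loewner_le k (M : R) :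
  (forall j, `|bprod k (a j)| <= M) -> (forall l, `|bprod k (b l)| <= M) ->
  0 <= M ->
  sigma (loewner x y r s) (2 * k).+1 <= M ^+ 2 * norm2 (loewner x y r s).
Proof.
move=> aM bM M0; set X := loewner x y r s.
pose D1 := diag_mx (\row_j (bprod k (a j))%:C).
pose D2 := diag_mx (\row_l (bprod k (b l))%:C).
pose W := D1 *m (X *m D2).
have X0 : 0 <= norm2 X by exact: sigma_ge0.
apply: (@sigma_le_rank R n _ X (X - W) W).
- by rewrite subrK.
- apply: leq_trans (rank_loewner_split k); apply: eq_leq; congr (\rank (_ - _)).
  rewrite /W -/X; move: X {X0 W} => Lw.
  by apply/matrixP => j l; rewrite /D1 /D2 mul_diag_mx mul_mx_diag !mxE rmorphM mulrCA.
- by rewrite mulr_ge0 // exprn_ge0.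
move=> v; rewrite /W -!mulmxA.
apply: le_trans (sqnorm_diag _ aM) _.
apply: (@le_trans _ _ ((M ^+ 2)%:C * ((norm2 X ^+ 2)%:C * ((M ^+ 2)%:C * sqnorm v)))).
  apply: ler_wpM2l; first by rewrite lecR sqr_ge0.
  apply: le_trans (sqnorm_le_norm2 _ _) _.
  apply: ler_wpM2l; first by rewrite lecR sqr_ge0.
  exact: sqnorm_diag.
have -> : ((M ^+ 2 * norm2 X) ^+ 2)%:C =
    (M ^+ 2)%:C * (norm2 X ^+ 2)%:C * (M ^+ 2)%:C :> C.
  by rewrite -!rmorphM /=; congr (_%:C); ring.
by rewrite !mulrA.
Qed.

End Split.

End Displacement.

Section Main.
Variable R : realType.
Local Notation C := R[i].

Lemma cross_ratioE (a b c d : R) : a < b -> b < c -> c < d ->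
  cross_ratio a b c d = (c - a) * (d - b) / ((c - b) * (d - a)).
Proof.
by move=> ab bc cd; rewrite /cross_ratio !ger0_norm // subr_ge0 ltW //; lra.
Qed.

Lemma cross_ratioN (a b c d : R) :
  cross_ratio (- b) (- a) (- d) (- c) = cross_ratio a b c d.
Proof.
have e u v : `|- u - - v| = `|u - v| :> R by rewrite -opprD normrN.
by rewrite /cross_ratio !e [_ * `|c - a|]mulrC [_ * `|c - b|]mulrC.
Qed.

(** Up to the scale [k0], [q] is the cross-ratio coordinate sending [c, b, d] to
0, infinity, 1, and [p] is the one sending [b, c, a] to 0, infinity, 1.  The
scale is the one for which [p * q] is the cross-ratio equal to 1 when the two
arguments coincide. *)
Lemma moebius_separate (a b c d : R) : a < b -> b < c -> c < d ->
  let k0 := Num.sqrt (1 - (cross_ratio a b c d)^-1) in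
  exists p q al be : R -> R,
  [/\ forall x, a <= x <= b -> 0 <= p x <= k0,
      forall y, c <= y <= d -> 0 <= q y <= k0 &
      forall x y, a <= x <= b -> c <= y <= d -> 1 - p x * q y = al x * be y * (x - y)].
Proof.
move=> ab bc cd k0.
have g1 : 1 - (cross_ratio a b c d)^-1 = (b - a) * (d - c) / ((c - a) * (d - b)).
  rewrite cross_ratioE //; field; rewrite !subr_eq0 !gt_eqF //; lra.
have k2 : k0 ^+ 2 = (b - a) * (d - c) / ((c - a) * (d - b)).
  rewrite sqr_sqrtr g1 //; apply: divr_ge0; apply: mulr_ge0; lra.
have k00 : 0 <= k0 by exact: sqrtr_ge0.
exists (fun x => k0 * ((b - x) * (c - a) / ((c - x) * (b - a)))).
exists (fun y => k0 * ((y - c) * (d - b) / ((y - b) * (d - c)))).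
exists (fun x => (c - b) / (x - c)), (fun y => (y - b)^-1); split.
- move=> x /andP[ax xb]; have h : 0 < (c - x) * (b - a) by apply: mulr_gt0; lra.
  rewrite mulr_ge0 //=; last by apply: divr_ge0; [apply: mulr_ge0; lra|exact: ltW].
  apply: ler_piMr => //; rewrite ler_pdivrMr // mul1r.
  have : 0 <= (x - a) * (c - b) by apply: mulr_ge0; lra.
  lra.
- move=> y /andP[cy yd]; have h : 0 < (y - b) * (d - c) by apply: mulr_gt0; lra.
  rewrite mulr_ge0 //=; last by apply: divr_ge0; [apply: mulr_ge0; lra|exact: ltW].
  apply: ler_piMr => //; rewrite ler_pdivrMr // mul1r.
  have : 0 <= (d - y) * (c - b) by apply: mulr_ge0; lra.
  lra.
move=> x y /andP[ax xb] /andP[cy yd].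
rewrite mulrACA -expr2 k2; field.
by do !(apply/andP; split); apply/eqP; lra.
Qed.

Lemma cross_ratio_gt1 (a b c d : R) : a < b -> b < c -> c < d ->
  1 < cross_ratio a b c d.
Proof.
move=> ab bc cd; rewrite cross_ratioE // ltr_pdivlMr; last by apply: mulr_gt0; lra.
have : 0 < (b - a) * (d - c) by apply: mulr_gt0; lra.
lra.
Qed.

(** The choice [L = ln (16 * gam)] makes [snq_mod L] at least
[Num.sqrt (1 - gam^-1)]. *)
Lemma eps_rank_loewner n (gam eps : R) (x y : 'I_n -> R) (r s : 'cV[C]_n)
    (p q al be : 'I_n -> R) :
  1 < gam -> 0 < eps < 1 ->
  (forall j l, x j != y l) ->
  (forall j, 0 <= p j <= Num.sqrt (1 - gam^-1)) ->
  (forall l, 0 <= q l <= Num.sqrt (1 - gam^-1)) ->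
  (forall j l, 1 - p j * q l = al j * be l * (x j - y l)) ->
  (eps_rank eps (loewner x y r s))%:Z <=
    2 * Num.ceil (ln (16 * gam) * ln (4 / eps) / pi ^+ 2).
Proof.
move=> g1 /andP[e0 e1] xy pk qk sep.
have g0 : 0 < gam by apply: lt_trans g1.
set L := ln (16 * gam).
have L0 : 0 < L by apply: ln_gt0; lra.
have l0 : 0 < ln (4 / eps) by apply: ln_gt0; rewrite ltr_pdivlMr //; lra.
have pi0 := @pi_gt0 R.
set z := L * ln (4 / eps) / pi ^+ 2.
have z0 : 0 < z by rewrite divr_gt0 ?mulr_gt0 ?exprn_gt0.
have : 0 < Num.ceil z by rewrite ceil_gt0.
have := ceil_ge z; case: (Num.ceil z) => // k zk; rewrite ltz_nat => k0.
have kt : Num.sqrt (1 - gam^-1) <= snq_mod L.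
  have t0 : 0 <= snq_mod L by exact: sqr_ge0.
  rewrite -[leRHS]ger0_norm // -sqrtr_sqr; apply: ler_wsqrtr.
  have := snq_mod_ge L0; rewrite expRN lnK ?posrE ?mulr_gt0 // invfM.
  by rewrite mulrA divff ?mul1r ?pnatr_eq0 //; lra.
have k1 : Num.sqrt (1 - gam^-1) < 1.
  by rewrite -[ltRHS]sqrtr1 ltr_sqrt // gtrBl invr_gt0.
have [xi xi01 hxi] := @zolotarev R L k L0 k0.
have eL : 4 * expR (- (pi ^+ 2 * k%:R / L)) <= eps.
  rewrite -ler_pdivlMl // -[leRHS]lnK ?posrE ?mulr_gt0 ?invr_gt0 // ler_expR.
  have -> : ln (4^-1 * eps) = - ln (4 / eps).
    by rewrite -lnV ?posrE ?divr_gt0 // invf_div mulrC.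
  by rewrite lerN2 ler_pdivlMr // [ln _ * L]mulrC [leRHS]mulrC -ler_pdivrMr ?exprn_gt0.
pose M := Num.sqrt eps.
have bnd t : 0 <= t <= Num.sqrt (1 - gam^-1) -> `|bprod xi k t| <= M.
  move=> /andP[t0 t1]; rewrite -sqrtr_sqr; apply: ler_wsqrtr.
  by apply: le_trans eL; apply: hxi; rewrite t0 (le_trans t1).
have lt1 t : 0 <= t <= Num.sqrt (1 - gam^-1) -> 0 <= t < 1.
  by move=> /andP[-> t1]; exact: le_lt_trans k1.
have := @sigma_loewner_le R n x y r s p q al be xi xy
  (fun j => lt1 _ (pk j)) (fun l => lt1 _ (qk l)) xi01 sep k M
  (fun j => bnd _ (pk j)) (fun l => bnd _ (qk l)) (sqrtr_ge0 _).
rewrite sqr_sqrtr ?(ltW e0) //.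
have [_ /(_ (2 * k)%N) h /h] := eps_rankP (loewner x y r s) (ltW e0).
by rewrite -[2 * Posz k]/(Posz (2 * k)) lez_nat.
Qed.

End Main.

Theorem mainTheorem12 (R : realType) (n : nat) (a b c d : R)
  (hab : a < b) (hcd : c < d) (hdisj : b < c \/ d < a)
  (x y : 'I_n -> R)
  (x_incr : forall j k : 'I_n, (j < k)%N -> x j < x k)
  (y_incr : forall j k : 'I_n, (j < k)%N -> y j < y k)
  (x_in : forall j : 'I_n, a <= x j <= b)
  (y_in : forall j : 'I_n, c <= y j <= d)
  (r s : 'cV[R[i]]_n) (eps : R) (heps : 0 < eps < 1) :
  (eps_rank eps (loewner x y r s))%:Z <=
    2 * Num.ceil (ln (16 * cross_ratio a b c d) * ln (4 / eps) / pi ^+ 2).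
Proof.
have xy j l : x j != y l.
  have /andP[h1 h2] := x_in j; have /andP[h3 h4] := y_in l.
  by case: hdisj => h; apply/eqP => e; lra.
case: hdisj => [bc|da].
  have [p [q [al [be [hp hq sep]]]]] := moebius_separate hab bc hcd.
  apply: (@eps_rank_loewner R n _ eps x y r s (p \o x) (q \o y) (al \o x) (be \o y)) => //.
  - exact: cross_ratio_gt1.
  - by move=> j; exact: hp.
  - by move=> l; exact: hq.
  - by move=> j l; exact: sep.
have hab' : - b < - a by rewrite ltrN2.
have hcd' : - d < - c by rewrite ltrN2.
have da' : - a < - d by rewrite ltrN2.
(* For d < a the reflection of both intervals at 0 is in the case b < c. *)
have [p [q [al [be [hp hq sep]]]]] := moebius_separate hab' da' hcd'.
rewrite -cross_ratioN.
have nx j : - b <= - x j <= - a by rewrite !lerN2 andbC.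
have ny j : - d <= - y j <= - c by rewrite !lerN2 andbC.
apply: (@eps_rank_loewner R n _ eps x y r s (fun j => p (- x j)) (fun l => q (- y l))
  (fun j => - al (- x j)) (fun l => be (- y l))) => //.
- exact: cross_ratio_gt1.
- by move=> j; exact: hp.
- by move=> l; exact: hq.
- by move=> j l; rewrite sep //; ring.
Qed.
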